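(* Let $\kappa$ be an infinite cardinal. For the collection $\mathfrak{K}$ of all coloring classes $K(\mathcal{W})$, where $\mathcal{W}$ is a set of allowed diagrams in a relational language $L$ of size $\kappa$, the Hanf number of $\mathfrak{K}$ for amalgamation exists and equals $\beth_{\kappa^+}$; likewise, the Hanf number of $\mathfrak{K}$ for disjoint amalgamation exists and equals $\beth_{\kappa^+}$.
   Context: Hanf number: for a family $\mathfrak{K}$ of classes, the Hanf number of $\mathfrak{K}$ for amalgamation (respectively, disjoint amalgamation) is the least cardinal $\lambda$ such that for every $K\in\mathfrak{K}$: $K$ has the (disjoint) amalgamation property in some $\mu>\lambda$ if and only if $K$ has the (disjoint) amalgamation property in all $\mu>\lambda$. Notation: $[A]^n$ is the set of $n$-element subsets of $A$, and $[n]=\{1,\dots,n\}$ (so $[0]=\emptyset$). $|M|$ is the universe of a structure $M$. All languages $L$ are relational with set of relation symbols $\mathcal{R}=\bigcup_{1\le n<\omega}\mathcal{R}_n$, where each $\mathcal{R}_n$ is a non-empty set of $n$-ary relation symbols; the size of $L$ is the cardinality of $\mathcal{R}$. An $L$-coloring structure is an $L$-structure $M$ for which there is a (coloring) function $c_M$, assigning to each non-empty finite subset of $|M|$ a symbol in $\mathcal{R}$, such that for distinct $a_1,\dots,a_n$ one has $c_M(\{a_1,\dots,a_n\})=P$ iff $M\models P(a_1,\dots,a_n)$. That is, each $P\in\mathcal{R}_n$ is a relation on $n$-element subsets of $|M|$, and the realizations of the symbols in $\mathcal{R}_n$ partition $[|M|]^n$. A substructure $M$ of an $L$-coloring structure $N$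 is monochromatic if for each $n\ge1$ and all $A,B\in[|M|]^n$, $c_N(A)=c_N(B)$. If $M$ is an $n$-element monochromatic structure, its diagram is the function $d_M:[n]\to\mathcal{R}$ with $d_M(k)=c_N(A)$ for any $k$-element subset $A$ of $M$. A set of allowed diagrams is a non-empty set $\mathcal{W}$ of functions $w:[n]\to\mathcal{R}$ ($n<\omega$) with $w(k)\in\mathcal{R}_k$ for $1\le k\le n$, closed under restrictions to $[m]$ for $m\le n$. The coloring class $K(\mathcal{W})$ is the class of all $L$-coloring structures $N$ such that $d_M\in\mathcal{W}$ for every finite monochromatic substructure $M$ of $N$; it is ordered by the substructure relation. $K$ has the amalgamation property in $\mu$ if for all $M_0,M_1,M_2\in K$ of cardinality $\mu$ with $M_0$ a substructure of $M_1$ and of $M_2$, there are $N\in K$ and embeddings $f_i:M_i\to N$ ($i=1,2$) with $f_1\restriction M_0=f_2\restriction M_0$ (in particular the property holds vacuously if $K$ has no models of cardinality $\mu$). It has the disjoint amalgamation property in $\mu$ if moreover $N,f_1,f_2$ can always be chosen with $f_1(M_1)\cap f_2(M_2)=f_1(M_0)$. *)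

(* Defs.v *)
From mathcomp Require Import all_boot.
From mathcomp Require Import all_classical wochoice.

Set Implicit Arguments.
Unset Strict Implicit.
Unset Printing Implicit Defensive.

Local Open Scope classical_set_scope.
Local Open Scope card_scope.

(** ** Cardinals and the beth hierarchy *)

(* A cardinal is represented by a type having that cardinality, so all notions
   below are meant up to equipotence.  The alias puts the symbols of the
   languages, the universes of the structures and the cardinals in one and the
   same type-theoretic universe. *)
Definition cardinal := Type.
Identity Coercion cardinal_sort : cardinal >-> Sortclass.

Definition card_lt (lam mu : cardinal) : Prop :=
  [set: lam] #<= [set: mu] /\ [set: lam] #!= [set: mu].

(* A point [x] of a (reflexive) well-order stands for the ordinal that is the
   order type of the set of its strict predecessors. *)
Definition below (I : Type) (R : rel I) (x : I) : set I :=
  [set y | R y x /\ y <> x].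

Definition is_zero (I : Type) (R : rel I) (x : I) : Prop := below R x = set0.

Definition is_succ (I : Type) (R : rel I) (y x : I) : Prop :=
  below R x = [set z | R z y].

Definition is_limit (I : Type) (R : rel I) (x : I) : Prop :=
  ~ is_zero R x /\ forall y, ~ is_succ R y x.

Definition is_sup (I : Type) (A : set I) (B : I -> cardinal) (lam : cardinal) :
    Prop :=
  (forall y, A y -> [set: B y] #<= [set: lam]) /\
  (forall mu : cardinal,
     (forall y, A y -> [set: B y] #<= [set: mu]) -> [set: lam] #<= [set: mu]).

(* [B x] has cardinality beth_alpha, for alpha the ordinal represented by [x]. *)
Definition beth_hierarchy (I : Type) (R : rel I) (B : I -> cardinal) : Prop :=
  [/\ forall x, is_zero R x -> [set: B x] #= [set: nat],
      forall y x, is_succ R y x -> [set: B x] #= [set: set (B y)]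
    & forall x, is_limit R x -> is_sup (below R x) B (B x)].

(* [x] represents the least ordinal of cardinality greater than [kappa]. *)
Definition is_succ_cardinal (kappa : cardinal) (I : Type) (R : rel I) (x : I) :
    Prop :=
  ~~ (below R x #<= [set: kappa]) /\
  forall y, below R x y -> below R y #<= [set: kappa].

(* [lam] has cardinality beth_{kappa^+}. *)
Definition is_beth_succ (kappa lam : cardinal) : Prop :=
  exists (I : cardinal) (R : rel I) (x : I) (B : I -> cardinal),
    [/\ well_order R, is_succ_cardinal kappa R x, beth_hierarchy R B
      & [set: lam] #= [set: B x]].

(** ** Languages, structures, colorings *)

(* The set R_n of the n-ary symbols is the fibre of [arity] over [n]. *)
Record language := Language {
  symbol :> cardinal;
  arity : symbol -> nat;
  arity_gt0 : forall P, 0 < arity P;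
  arity_surj : forall n, 0 < n -> exists P, arity P = n }.

Definition has_size (L : language) (kappa : cardinal) : Prop :=
  [set: L] #= [set: kappa].

Record structure (L : language) := Structure {
  carrier :> cardinal;
  holds : forall P : L, ('I_(arity P) -> carrier) -> Prop }.

(* Only the values of [c] on the non-empty finite subsets of [M] matter.  The
   last clause says that the symbols denote relations on sets of elements: they
   never hold of a tuple with repetitions. *)
Definition is_coloring (L : language) (M : structure L) (c : set M -> L) :
    Prop :=
  [/\ forall n (A : set M), 0 < n -> A #= `I_n -> arity (c A) = n,
      forall (P : L) (a : 'I_(arity P) -> M), injective a ->
        (c (range a) = P <-> holds a)
    & forall (P : L) (a : 'I_(arity P) -> M), holds a -> injective a].

(* Languages being relational, the substructures of [M] are its subsets. *)
Definition monochromatic (T : Type) (L : language) (c : set T -> L)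
    (A : set T) : Prop :=
  forall n (B C : set T), 0 < n -> B `<=` A -> C `<=` A ->
    B #= `I_n -> C #= `I_n -> c B = c C.

(* A function w : [n] -> R is encoded as [w : 'I_n -> L], with w(k) at index
   k - 1. *)
Definition is_diagram (T : Type) (L : language) (c : set T -> L) (A : set T)
    (n : nat) (d : 'I_n -> L) : Prop :=
  forall (k : 'I_n) (B : set T), B `<=` A -> B #= `I_k.+1 -> c B = d k.

Record allowed_diagrams (L : language) := AllowedDiagrams {
  allowed :> forall n, ('I_n -> L) -> Prop;
  allowed_nonempty : exists n (w : 'I_n -> L), allowed w;
  allowed_arity : forall n (w : 'I_n -> L), allowed w ->
    forall k : 'I_n, arity (w k) = k.+1;
  allowed_restr : forall m n (le_mn : m <= n) (w : 'I_n -> L), allowed w ->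
    allowed (fun k : 'I_m => w (widen_ord le_mn k)) }.

Definition coloring_class (L : language) (W : allowed_diagrams L)
    (N : structure L) : Prop :=
  exists c : set N -> L, is_coloring c /\
    forall n (A : set N) (d : 'I_n -> L), A #= `I_n -> monochromatic c A ->
      is_diagram c A d -> W n d.

(** ** Amalgamation and Hanf numbers *)

(* Classes of structures in a common language, always ordered by the
   substructure relation. *)
Record struct_class := StructClass {
  class_lang : language;
  models :> structure class_lang -> Prop }.

Definition embedding (L : language) (M N : structure L) (f : M -> N) : Prop :=
  injective f /\
  forall (P : L) (a : 'I_(arity P) -> M), holds a <-> holds (f \o a).

Definition has_card (L : language) (M : structure L) (mu : cardinal) : Prop :=
  [set: M] #= [set: mu].

(* "M0 is a substructure of M1 and of M2" is rendered by embeddings g1 and g2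
   playing the role of the inclusions. *)
Definition amalgamation (K : struct_class) (mu : cardinal) : Prop :=
  forall (M0 M1 M2 : structure (class_lang K)) (g1 : M0 -> M1) (g2 : M0 -> M2),
    K M0 -> K M1 -> K M2 ->
    has_card M0 mu -> has_card M1 mu -> has_card M2 mu ->
    embedding g1 -> embedding g2 ->
  exists (N : structure (class_lang K)) (f1 : M1 -> N) (f2 : M2 -> N),
    [/\ K N, embedding f1, embedding f2 & f1 \o g1 = f2 \o g2].

Definition disjoint_amalgamation (K : struct_class) (mu : cardinal) : Prop :=
  forall (M0 M1 M2 : structure (class_lang K)) (g1 : M0 -> M1) (g2 : M0 -> M2),
    K M0 -> K M1 -> K M2 ->
    has_card M0 mu -> has_card M1 mu -> has_card M2 mu ->
    embedding g1 -> embedding g2 ->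
  exists (N : structure (class_lang K)) (f1 : M1 -> N) (f2 : M2 -> N),
    [/\ K N, embedding f1, embedding f2, f1 \o g1 = f2 \o g2
      & range f1 `&` range f2 = range (f1 \o g1)].

Definition hanf_bound (F : struct_class -> Prop)
    (AP : struct_class -> cardinal -> Prop) (lam : cardinal) : Prop :=
  forall K, F K ->
    (exists mu, card_lt lam mu /\ AP K mu) <->
    (forall mu, card_lt lam mu -> AP K mu).

Definition is_hanf_number (F : struct_class -> Prop)
    (AP : struct_class -> cardinal -> Prop) (lam : cardinal) : Prop :=
  hanf_bound F AP lam /\
  forall mu, hanf_bound F AP mu -> [set: lam] #<= [set: mu].

Definition coloring_classes (kappa : cardinal) (K : struct_class) : Prop :=
  exists (L : language) (W : allowed_diagrams L),
    has_size L kappa /\ K = StructClass (coloring_class W).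

(* Main.v *)
Require Import Defs.
From mathcomp Require Import all_boot.
From mathcomp Require Import all_classical wochoice.

(** A homogeneous set, being monochromatic on singletons, consists of points of a
    single color, so only the sets of points of the same color restrict the
    amalgams.  Say that a color P of points is good if some infinite branch of
    allowed diagrams starts with P.

    Upper bound.  If a coloring with [kappa] colors has more than beth_{kappa^+}
    points, the diagrams of its homogeneous sets contain an infinite branch
    (infinite_branch, an end-homogeneous version of the Erdos-Rado theorem).
    Hence a model has at most beth_{kappa^+} points in each color that is not
    good, and there is a good color as soon as there are larger models.  Models
    whose points have a good color are amalgamated disjointly by coloring the new
    sets along the branch (amalgam_branch).  Models whose points have another
    color P are, by their size, the parts of color P of models of any given
    larger cardinality [mu], obtained by adding [mu] points of a good color; so
    amalgamation in [mu] amalgamates them, and even disjointly, because the added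
    points can code which new points belong to which model
    (amalgam_rare_color).  Gluing the amalgams for the various colors
    (amalgam_glue) gives amalgamation in every other large cardinality.  Coding
    is impossible only if sets of the same size n >= 2 have the same color, and
    then amalgams are found by identifying points (amalgam_identify).

    Lower bound.  For y < kappa^+, a set of size beth_y has a coloring with
    [kappa] colors and no infinite branch: such colorings pass to sums of
    [kappa] sets, and to powersets by coloring a family of sets through the first
    differences of its members (wf_colorable_beth).  Adding [kappa] points of a new
    color, over which two points cannot be amalgamated whatever the color of the
    pair that they form, gives a class without amalgamation in some cardinality
    at least beth_y, whereas it has no models above beth_{kappa^+} and
    amalgamates there (sparse_not_amalgamates, sparse_bounded). *)

Set Implicit Arguments.
Unset Strict Implicit.
Unset Printing Implicit Defensive.

Local Open Scope classical_set_scope.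
Local Open Scope card_scope.

(** * Cardinal arithmetic *)

(** The relation |A| <= |B| between types; the cardinalities of sets are those of
    the corresponding subtypes. *)
Definition emb (A B : Type) : Prop := exists f : A -> B, injective f.

Lemma emb_refl A : emb A A. Proof. by exists id. Qed.

Lemma emb_trans B A C : emb A B -> emb B C -> emb A C.
Proof. by move=> [f fi] [g gi]; exists (g \o f); apply: inj_comp. Qed.

Lemma sig_inj T (P : T -> Prop) : injective (@sval T P).
Proof. by move=> [x px] [y py] /= xy; apply: eq_exist. Qed.

Lemma emb_sig T (P : T -> Prop) : emb {x | P x} T.
Proof. by exists sval; apply: sig_inj. Qed.

Lemma card_le_emb A B (X : set A) (Y : set B) :
  X #<= Y <-> emb {x | X x} {y | Y y}.
Proof.
split=> [/card_leP/injfunPex[f _ fi]|[f fi]].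
  exists (fun x => let y := f (exist _ (sval x) (mem_set (svalP x))) in
     exist _ (sval y) (set_mem (svalP y))).
  move=> x y e; apply: sig_inj.
  have e' : f (exist _ (sval x) (mem_set (svalP x))) =
            f (exist _ (sval y) (mem_set (svalP y))).
    by apply: val_inj; exact: (congr1 sval e).
  by have [] := fi _ _ (mem_set I) (mem_set I) e'.
apply/card_leP/injfunPex.
exists (fun x => let y := f (exist _ (sval x) (set_mem (svalP x))) in
     exist _ (sval y) (mem_set (svalP y))) => //.
move=> x y _ _ e; apply: val_inj.
have /fi [] // : f (exist _ (sval x) (set_mem (svalP x))) =
                 f (exist _ (sval y) (set_mem (svalP y))).
by apply: sig_inj; exact: (congr1 sval e).
Qed.

Lemma emb_extend S T (X : set S) (Y : set T) : T -> emb {x | X x} {y | Y y} ->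
  exists h : S -> T, (forall x, X x -> Y (h x)) /\
    forall x y, X x -> X y -> h x = h y -> x = y.
Proof.
move=> t [f fi]; exists (fun x => match pselect (X x) with
  | left h => sval (f (exist _ x h)) | right _ => t end); split.
  by move=> x Xx; case: pselect => // h; exact: svalP (f _).
move=> x y Xx Xy; case: pselect => // h; case: pselect => // h'.
by move=> /sig_inj/fi[].
Qed.

Lemma emb_sigT A : emb A {x : A | [set: A] x}.
Proof. by exists (fun x => exist _ x I) => x y []. Qed.

Lemma setT_card_le A B : [set: A] #<= [set: B] <-> emb A B.
Proof.
split=> [/card_le_emb e|e].
  exact: emb_trans (emb_sigT A) (emb_trans e (emb_sig _)).
by apply/card_le_emb; apply: emb_trans (emb_sig _) (emb_trans e (emb_sigT B)).
Qed.

Lemma set_card_le A B (X : set A) : X #<= [set: B] <-> emb {x | X x} B.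
Proof.
split=> [/card_le_emb e|e]; first exact: emb_trans e (emb_sig _).
by apply/card_le_emb; exact: emb_trans e (emb_sigT B).
Qed.

Lemma setT_card_eq A B : [set: A] #= [set: B] <-> emb A B /\ emb B A.
Proof. by rewrite card_eqPle; split=> -[/setT_card_le ? /setT_card_le ?]. Qed.

Lemma infinite_emb A : infinite_set [set: A] <-> emb nat A.
Proof. by rewrite infiniteP; exact: setT_card_le. Qed.

(** Zorn's lemma applied to the partial injections from one type to the other,
    seen as graphs: a maximal one is total or surjective. *)
Lemma emb_total A B : emb A B \/ emb B A.
Proof.
pose P (G : set (A * B)) := forall p q, G p -> G q -> p.1 = q.1 <-> p.2 = q.2.
have [F FP Ft|G [GP Gmax]] := @Zorn_bigcup _ P.
  move=> p q [X FX Xp] [Y FY Yq].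
  have [XY|YX] := Ft _ _ FX FY.
    exact: (FP _ FY) (XY _ Xp) Yq.
  exact: (FP _ FX) Xp (YX _ Yq).
have [Gdom|/existsNP[a Ga]] := pselect (forall a, exists b, G (a, b)).
  left; have [f fG] := choice Gdom; exists f => x y fxy.
  by have /(_ fxy) := (GP _ _ (fG x) (fG y)).2.
have [Gran|/existsNP[b Gb]] := pselect (forall b, exists a, G (a, b)).
  right; have [f fG] := choice Gran; exists f => x y fxy.
  by have /(_ fxy) := (GP _ _ (fG x) (fG y)).1.
exfalso; apply: (Gmax (G `|` [set (a, b)])).
  split; first by move=> p; left.
  by move=> /(_ (a, b) (or_intror erefl)) Gab; apply: Ga; exists b.
move=> [x y] [x' y'] /= [Gp|[-> ->]] [Gq|[-> ->]] //.
- exact: GP Gp Gq.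
- by split=> e; subst; [case: Ga; exists y|case: Gb; exists x].
- by split=> e; subst; [case: Ga; exists y'|case: Gb; exists x'].
Qed.

Lemma cantor A : ~ emb (set A) A.
Proof.
move=> [f fi]; pose D := [set x | exists X, f X = x /\ ~ X x].
have [Df|Df] := pselect (D (f D)); last by apply: (Df); exists D.
by have [X [/fi ->]] := Df.
Qed.

Lemma emb_set1 A : emb A (set A).
Proof.
exists (fun x => [set x]) => x y e.
by have : [set x] y by rewrite e.
Qed.

Lemma image_set_inj A B (f : A -> B) : injective f ->
  injective (fun X : set A => f @` X).
Proof.
move=> fi; have sub X Y : f @` X = f @` Y -> X `<=` Y.
  move=> e x Xx; have : (f @` Y) (f x) by rewrite -e; exists x.
  by move=> [y Yy /fi <-].
by move=> X Y e; apply/seteqP; split; apply: sub.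
Qed.

Lemma emb_set A B : emb A B -> emb (set A) (set B).
Proof. by move=> [f /image_set_inj fi]; exists (fun X => f @` X). Qed.

Lemma emb_prod A B A' B' : emb A A' -> emb B B' -> emb (A * B) (A' * B').
Proof.
move=> [f fi] [g gi]; exists (fun p => (f p.1, g p.2)).
by move=> [a b] [c d] [/fi -> /gi ->].
Qed.

Lemma emb_bool_nat A : emb nat A -> emb bool A.
Proof. by apply: emb_trans; exists nat_of_bool => -[] []. Qed.

Lemma emb_sum_bool A B C : emb A C -> emb B C -> emb (A + B) (bool * C).
Proof.
move=> [f fi] [g gi].
exists (fun s => match s with inl a => (true, f a) | inr b => (false, g b) end).
by move=> [a|b] [a'|b'] //= []; [move=> /fi -> | move=> /gi ->].
Qed.

(** An infinite set has the cardinality of its square: the graph of an injection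
    D * D -> D, for D infinite, which Zorn's lemma makes maximal, must have a
    domain D as large as the whole type; otherwise a copy of D inside the
    complement of D leaves room for extending the injection. *)
Lemma emb_square A : emb nat A -> emb (A * A) A.
Proof.
move=> [e ei].
pose dom (G : set (A * A * A)) := [set x | exists z, G (x, x, z)].
pose P0 (G : set (A * A * A)) :=
  [/\ forall x y z, G (x, y, z) -> [/\ dom G x, dom G y & dom G z],
      forall x y, dom G x -> dom G y -> exists z, G (x, y, z)
    & forall p q, G p -> G q -> p.1 = q.1 <-> p.2 = q.2].
have [pn pni] : emb (nat * nat) nat.
  by apply/setT_card_le; case/card_eqPle: card_nat2.
pose G0 : set (A * A * A) := [set p | exists i j,
  p = (e i, e j, e (pn (i, j)))].
have G0dom i : dom G0 (e i) by exists (e (pn (i, i))), i, i.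
have PG0 : P0 G0.
  split.
  - by move=> x y z [i [j [-> -> ->]]].
  - move=> x y [_ [i [_ [-> _ _]]]] [_ [j [_ [-> _ _]]]].
    by exists (e (pn (i, j))), i, j.
  - move=> _ _ [i [j ->]] [k [l ->]] /=; split.
      by move=> [/ei -> /ei ->].
    by move=> /ei/pni [-> ->].
(* The graph G0 lives on a copy of nat; it forces the domain to be infinite. *)
pose P G := P0 (G0 `|` G).
have [F FP Ft|G1 [G1P G1max]] := @Zorn_bigcup _ P.
  have [[X FX]|F0] := pselect (exists X, F X); last first.
    rewrite /P (_ : \bigcup_(X in F) X = set0) ?setU0 //.
    by apply/seteqP; split=> // p [X FX _]; case: F0; exists X.
  rewrite /P; set U := _ `|` _.
  have chain p q : U p -> U q -> exists Y, [/\ F Y, (G0 `|` Y) p & (G0 `|` Y) q].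
    have up Y r : F Y -> U r -> exists Z, [/\ F Z, Y `<=` Z & (G0 `|` Z) r].
      move=> FY [G0r|[Z FZ Zr]]; first by exists Y; split => //; left.
      have [YZ|ZY] := Ft _ _ FY FZ; first by exists Z; split => //; right.
      by exists Y; split => //; right; apply: ZY.
    move=> Up Uq; have [Y [FY _ Yp]] := up _ _ FX Up.
    have [Z [FZ YZ Zq]] := up _ _ FY Uq.
    by exists Z; split => //; case: Yp; [left|move=> /YZ; right].
  have inU Y : F Y -> G0 `|` Y `<=` U.
    by move=> FY p [?|?]; [left|right; exists Y].
  have inD Y : F Y -> dom (G0 `|` Y) `<=` dom U.
    by move=> FY x [z Yz]; exists z; apply: inU Yz.
  split.
  - move=> x y z Uxyz; have [Y [FY Yxyz _]] := chain _ _ Uxyz Uxyz.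
    have [Y1 _ _] := FP _ FY; have [*] := Y1 _ _ _ Yxyz.
    by split; apply: inD FY _ _.
  - move=> x y [z Uz] [z' Uz']; have [Y [FY Yz Yz']] := chain _ _ Uz Uz'.
    have [_ Y2 _] := FP _ FY.
    have [u Yu] := Y2 x y (ex_intro _ z Yz) (ex_intro _ z' Yz').
    by exists u; apply: inU Yu.
  - move=> p q Up Uq; have [Y [FY Yp Yq]] := chain _ _ Up Uq.
    by have [_ _] := FP _ FY; apply.
set G := G0 `|` G1; have [Gd Gt Gi] : P0 G := G1P.
pose D := {x | dom G x}.
have GD : emb (D * D) D.
  have tot (p : D * D) : exists z : D, G (sval p.1, sval p.2, sval z).
    case: p => -[x Dx] [y Dy] /=; have [z Gz] := Gt _ _ Dx Dy.
    by have [_ _ Dz] := Gd _ _ _ Gz; exists (exist _ z Dz).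
  have [f fG] := choice tot; exists f => -[x y] [x' y'] fe.
  move: (fG (x, y)) (fG (x', y')); rewrite fe => /Gi h /h /= [_ /(_ erefl)].
  by move=> [/sig_inj -> /sig_inj ->].
have natD : emb nat D.
  have De i : dom G (e i) by have [z ?] := G0dom i; exists z; left.
  by exists (fun i => exist _ (e i) (De i)) => i j [/ei].
have boolD : emb (bool * D) D.
  by apply: emb_trans GD; apply: emb_prod (emb_refl _); apply: emb_bool_nat.
have splitA (X : set A) : emb A ({x | X x} + {x | ~ X x}).
  exists (fun x => match pselect (X x) with
     left h => inl (exist _ x h) | right h => inr (exist _ x h) end).
  by move=> x y; case: pselect => h; case: pselect => h' //= [].
have [le|[g gi]] := emb_total {x | ~ dom G x} D.
  have AD : emb A D.
    apply: emb_trans (splitA (dom G)) _; apply: emb_trans boolD.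
    by apply: emb_sum_bool le; apply: emb_refl.
  exact: emb_trans (emb_prod AD AD) (emb_trans GD (emb_sig _)).
exfalso.
(* The extension of the injection to D' sends the new pairs into the copy of D
   that g embeds in the complement of D. *)
pose D' := [set x | dom G x \/ exists d, x = sval (g d)].
have [k ki] : emb ({x | D' x} * {x | D' x}) D.
  have D'D : emb {x | D' x} D.
    apply: emb_trans boolD; apply: (@emb_trans (D + D)); last first.
      by apply: emb_sum_bool; apply: emb_refl.
    have sp (x : {x | D' x}) : exists s : D + D,
       sval x = match s with inl d => sval d | inr d => sval (g d) end.
      by case: x => x [Dx|[d xd]]; [exists (inl (exist _ x Dx))|exists (inr d)].
    have [f fP] := choice sp; exists f => x y xy; apply: sig_inj.
    by rewrite !fP xy.
  exact: emb_trans (emb_prod D'D D'D) GD.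
pose G' : set (A * A * A) := [set p | exists (x y : {x | D' x}),
   [/\ p = (sval x, sval y, sval (g (k (x, y))))
     & ~ (dom G (sval x) /\ dom G (sval y))]].
have G'nd p : G' p -> ~ dom G p.2.
  by move=> [x [y [-> _]]] /=; exact: (svalP (g _)).
have GG' : dom (G `|` G') = D'.
  apply/seteqP; split=> x.
    by move=> [z [Gz|[x' [y' [[-> _ _] _]]]]]; [left; exists z|exact: svalP].
  move=> D'x; have [Dx|nDx] := pselect (dom G x).
    by have [z Gz] := Dx; exists z; left.
  exists (sval (g (k (exist _ x D'x, exist _ x D'x)))); right.
  by exists (exist _ x D'x), (exist _ x D'x); split=> //= -[].
have PG' : P (G1 `|` G').
  rewrite /P setUA -/G; split.
  - rewrite GG' => x y z [/Gd[? ? ?]|[x' [y' [[-> -> ->] _]]]].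
      by split; left.
    by split; [exact: svalP|exact: svalP|right; exists (k (x', y'))].
  - rewrite GG' => x y D'x D'y.
    have [[Dx Dy]|nD] := pselect (dom G x /\ dom G y).
      by have [z Gz] := Gt _ _ Dx Dy; exists z; left.
    exists (sval (g (k (exist _ x D'x, exist _ y D'y)))); right.
    by exists (exist _ x D'x), (exist _ y D'y).
  - have cross p q : G p -> G' q -> p.1 = q.1 <-> p.2 = q.2.
      move=> Gp G'q; split=> e1.
        case: G'q => x [y [qE []]]; move: Gp e1.
        case: p => -[a b] c /Gd[? ? _]; rewrite qE /= => -[<- <-].
        by split.
      by case: (G'nd _ G'q); rewrite -e1; move: Gp; case: p {e1} => -[a b] c /Gd[].
    move=> p q [Gp|G'p] [Gq|G'q].
    + exact: Gi.
    + exact: cross.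
    + by split=> /esym e1; apply/esym; apply/(cross q p).
    + case: G'p G'q => x [y [-> _]] [x' [y' [-> _]]] /=; split.
        by move=> [/sig_inj -> /sig_inj ->].
      by move=> /sig_inj/gi/ki [-> ->].
have d0 : dom G (e 0) by have [z ?] := G0dom 0; exists z; left.
pose g0 := g (exist _ (e 0) d0).
have D'g0 : D' (sval g0) by right; exists (exist _ (e 0) d0).
apply: (G1max (G1 `|` G')) PG'; split; first by move=> p; left.
pose y0 : {x | D' x} := exist _ _ D'g0.
pose p0 := (sval y0, sval y0, sval (g (k (y0, y0)))).
have G'p0 : G' p0 by exists y0, y0; split=> // -[/(svalP g0)].
move=> /(_ p0 (or_intror G'p0)) G1p0; have : G p0 by right.
by move=> /Gd[/(svalP g0)].
Qed.

Lemma emb_pair A B X : emb nat X -> emb A X -> emb B X -> emb (A * B) X.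
Proof.
by move=> iX AX BX; apply: emb_trans (emb_square iX); apply: emb_prod.
Qed.

Lemma emb_sum A B X : emb nat X -> emb A X -> emb B X -> emb (A + B) X.
Proof.
move=> iX AX BX; apply: emb_trans (emb_sum_bool AX BX) _.
by apply: emb_pair => //; [exact: emb_bool_nat|exact: emb_refl].
Qed.

Lemma emb_sigma I (F : I -> Type) X :
  emb nat X -> emb I X -> (forall i, emb (F i) X) -> emb {i & F i} X.
Proof.
move=> iX IX FX; apply: emb_trans (emb_pair iX IX (emb_refl X)).
exists (fun p => (tag p, sval (cid (FX (tag p))) (tagged p))).
move=> [i a] [j b] /= [ij]; case: j / ij b => b.
by move=> /(svalP (cid (FX i))) ->.
Qed.

Lemma tag_inj I (F : I -> Type) i : injective (@existT I F i).
Proof.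
move=> a b e; pose r (p : {i & F i}) := match pselect (tag p = i) with
  | left e => Some (ecast j (F j) e (tagged p)) | right _ => None end.
have rE c : r (existT F i c) = Some c.
  by rewrite /r /=; case: pselect => // e'; rewrite (Prop_irrelevance e' erefl).
by have := congr1 r e; rewrite !rE => -[].
Qed.

Lemma emb_tag I (F : I -> Type) i : emb (F i) {i & F i}.
Proof. by exists (existT F i); apply: tag_inj. Qed.

Lemma emb_option_inf A X : emb nat X -> emb A X -> emb (option A) X.
Proof.
move=> iX AX; apply: (@emb_trans (A + unit)); last first.
  by apply: emb_sum => //; apply: emb_trans iX; exists (fun=> 0) => -[] [].
exists (fun o => if o is Some a then inl a else inr tt).
by move=> [a|] [b|] //= [->].
Qed.

(** * Well-orders *)

Section WellOrder.
Variables (T : Type) (R : rel T).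
Hypothesis Rwo : well_order R.

Lemma wo_least (A : set T) : A !=set0 -> exists2 z, A z & forall x, A x -> R z x.
Proof.
move=> [a Aa]; have [|z [[Az zmin] _]] := Rwo (A := mem A).
  by exists a; rewrite inE.
exists z; first by move: Az; rewrite inE.
by move=> x Ax; apply: zmin; rewrite inE.
Qed.

Lemma wo_total x y : R x y \/ R y x.
Proof.
have [|z [<-|<-] zmin] := @wo_least [set x; y]; first by exists x; left.
  by left; apply: zmin; right.
by right; apply: zmin; left.
Qed.

Lemma wo_refl x : R x x. Proof. by case: (wo_total x x). Qed.

Lemma wo_anti x y : R x y -> R y x -> x = y.
Proof.
move=> xy yx; have [|z [_ uniq]] := Rwo (A := mem [set x; y]).
  by exists x; rewrite inE; left.
have ux : z = x.
  apply: uniq; split; first by rewrite inE; left.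
  by move=> u; rewrite inE => -[->|->] //; apply: wo_refl.
have uy : z = y.
  apply: uniq; split; first by rewrite inE; right.
  by move=> u; rewrite inE => -[->|->] //; apply: wo_refl.
by rewrite -ux.
Qed.

Lemma wo_trans y x z : R x y -> R y z -> R x z.
Proof.
move=> xy yz; have [|u us umin] := @wo_least [set t | [\/ t = x, t = y | t = z]].
  by exists x; constructor 1.
have ux : R u x by apply: umin; constructor 1.
have uy : R u y by apply: umin; constructor 2.
have uz : R u z by apply: umin; constructor 3.
case: us => e; subst u => //.
  by rewrite (wo_anti xy ux).
by rewrite (wo_anti uy yz).
Qed.

Lemma below_irr x : ~ below R x x. Proof. by case. Qed.

Lemma below_notR x y : below R x y -> ~ R x y.
Proof. by move=> [yx ne] xy; apply: ne; apply: wo_anti. Qed.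

Lemma not_below x y : ~ below R x y -> R x y.
Proof.
move=> nb; case: (wo_total x y) => // yx.
have [->|ne] := pselect (y = x); first exact: wo_refl.
by case: nb.
Qed.

Lemma below_tricho x y : [\/ below R x y, x = y | below R y x].
Proof.
have [->|ne] := pselect (x = y); first by constructor 2.
case: (wo_total x y) => h; first by constructor 3.
by constructor 1; split=> // e; apply: ne.
Qed.

Lemma below_le y x z : below R x y -> R x z -> below R z y.
Proof.
move=> [yx ne] xz; split; first exact: wo_trans xz.
by move=> e; subst z; apply: ne; apply: wo_anti.
Qed.

Lemma le_below y x z : R y x -> below R z x -> below R z y.
Proof.
move=> yx [xz ne]; split; first exact: wo_trans xz.
by move=> e; subst z; apply: ne; apply: wo_anti.
Qed.

Lemma below_trans y x z : below R y x -> below R z y -> below R z x.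
Proof. by move=> xy [yz _]; apply: below_le yz. Qed.

Lemma below_wf : well_founded (fun x y => below R y x).
Proof.
move=> a; apply: contrapT => na.
have [|z nz zmin] := @wo_least [set x | ~ Acc (fun x y => below R y x) x].
  by exists a.
apply: nz; constructor => y yz; apply: contrapT => ny.
exact: below_notR yz (zmin _ ny).
Qed.

Lemma wo_min (P : T -> Prop) : (exists x, P x) ->
  exists2 z, P z & forall y, below R z y -> ~ P y.
Proof.
by move=> /wo_least[z Pz zmin]; exists z => // y /below_notR nzy /zmin.
Qed.

End WellOrder.

Lemma ex_well_order (T : Type) : exists R : rel T, well_order R.
Proof. by elim/Peq: T => T; case: (well_ordering_principle T) => R; exists R. Qed.

(** * Finite sets *)

Section FiniteSets.
Variable T : Type.
Implicit Types (A B : set T) (n : nat).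

Lemma card_I0P A : A #= `I_0 <-> A = set0.
Proof.
by rewrite II0 card_eq0; split=> [/eqP|->].
Qed.

Lemma card_IU1 x A n : ~ A x -> A #= `I_n -> (x |` A) #= `I_n.+1.
Proof.
move=> nAx An; apply/eq_cardSP; exists x; first by left.
rewrite (_ : _ `\ x = A) //; apply/seteqP; split=> y /=.
  by move=> [[->|] //] /(_ erefl).
by move=> Ay; split; [right|move=> e; subst y].
Qed.

Lemma card_ID1 x A n : A x -> A #= `I_n.+1 -> A `\ x #= `I_n.
Proof.
move=> Ax /[dup] An1 /eq_cardSP[y Ay An].
have : x |` (A `\ x) = A.
  apply/seteqP; split=> z; first by move=> [->|[]].
  by have [->|ne] := pselect (z = x); [left|right; split].
have [m Am] : finite_set (A `\ x).
  by apply: finite_setD; exists n.+1.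
have nx : ~ (A `\ x) x by move=> [_]; apply.
move=> e; have := card_IU1 nx Am; rewrite e => Am1.
have /card_eq_II [<-] // : `I_m.+1 #= `I_n.+1.
by apply: card_eq_trans An1; apply: card_esym.
Qed.

Lemma card_I_inj A n m : A #= `I_n -> A #= `I_m -> n = m.
Proof.
move=> An Am; apply/card_eq_II.
by apply: card_eq_trans Am; apply: card_esym.
Qed.

Lemma card_I_sub A B n : A `<=` B -> B #= `I_n -> exists2 m, m <= n & A #= `I_m.
Proof.
move=> AB Bn; have [m Am] : finite_set A by apply: sub_finite_set AB _; exists n.
exists m => //; rewrite -card_le_II.
have: A #<= B by apply: subset_card_le.
by rewrite (card_le_eql Am) (card_le_eqr Bn).
Qed.

Lemma card_between A B j m n : A `<=` B -> A #= `I_j -> B #= `I_n ->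
  j <= m <= n -> exists C, [/\ A `<=` C, C `<=` B & C #= `I_m].
Proof.
move=> AB Aj Bn /andP[jm mn].
elim: m jm mn => [|m IH] jm mn.
  by exists A; split=> //; move: jm Aj; rewrite leqn0 => /eqP ->.
move: jm; rewrite leq_eqVlt => /orP[/eqP <-|jm]; first by exists A; split.
have [C [AC CB Cm]] := IH jm (ltnW mn).
have [[b Bb nCb]|noB] := pselect (exists2 b, B b & ~ C b); last first.
  have CBe : C = B.
    apply/seteqP; split=> // b Bb; apply: contrapT => nCb; apply: noB.
    by exists b.
  by subst C; move: mn; rewrite (card_I_inj Cm Bn) ltnn.
exists (b |` C); split; last exact: card_IU1.
  by move=> x Ax; right; apply: AC.
by move=> x [->|/CB].
Qed.

Lemma card_I1P A : A #= `I_1 <-> exists x, A = [set x].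
Proof.
split=> [/eq_cardSP[x Ax /card_I0P A0]|[x ->]]; last exact: card_set1.
exists x; apply/seteqP; split=> [y Ay|_ -> //].
apply: contrapT => ne; have : (A `\ x) y by split.
by rewrite A0.
Qed.

Lemma card_I2 (x y : T) : x <> y -> [set x; y] #= `I_2.
Proof.
by move=> ne; apply: card_IU1; [move=> /= e; apply: ne|exact: card_set1].
Qed.

Lemma card_I2P A : A #= `I_2 <-> exists x y, x <> y /\ A = [set x; y].
Proof.
split=> [/eq_cardSP[x Ax /card_I1P[y Ay]]|[x [y [ne ->]]]]; last exact: card_I2.
have [Ay' ny] : (A `\ x) y by rewrite Ay.
exists x, y; split=> [e|]; first exact: ny.
apply/seteqP; split=> [z Az|z [->|->] //].
have [->|ne] := pselect (z = x); first by left.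
by right; have : (A `\ x) z by []; rewrite Ay.
Qed.

Lemma card_I3 (x y z : T) : x <> y -> x <> z -> y <> z -> [set x; y; z] #= `I_3.
Proof.
move=> xy xz yz; rewrite setUC; apply: card_IU1; last exact: card_I2.
by case=> /= e; [apply: xz|apply: yz].
Qed.

Lemma card_nonempty A n : 0 < n -> A #= `I_n -> A !=set0.
Proof. by case: n => // n _ /eq_cardSP[x Ax _]; exists x. Qed.

Lemma card_range n (a : 'I_n -> T) : injective a -> range a #= `I_n.
Proof.
move=> ai; apply: card_eq_trans (card_esym card_II).
by apply: inj_card_eq => x y _ _; apply: ai.
Qed.

Lemma card_enum A n : A #= `I_n ->
  exists a : 'I_n -> T, injective a /\ range a = A.
Proof.
elim: n A => [|n IH] A.
  move=> /card_I0P ->; exists (fun i : 'I_0 => False_rect T (notF (ltn_ord i))).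
  by split=> [[]//|]; apply/seteqP; split=> // x [[]].
move=> /eq_cardSP[x Ax /IH [a [ai ar]]].
exists (fun i => if unlift ord0 i is Some j then a j else x); split.
  have nx j : a j <> x.
    move=> e; have : (A `\ x) (a j) by rewrite -ar; exists j.
    by rewrite e => -[_]; apply.
  move=> i j; case: unliftP => [i'|] ->; case: unliftP => [j'|] -> //.
  - by move=> /ai ->.
  - by move=> /nx.
  - by move=> /esym/nx.
apply/seteqP; split=> [_ [i _ <-]|y Ay].
  case: unliftP => [j|] _ //; have : (A `\ x) (a j) by rewrite -ar; exists j.
  by case.
have [->|ne] := pselect (y = x); first by exists ord0; rewrite ?unlift_none.
have : (A `\ x) y by []; rewrite -ar => -[j _ <-].
by exists (lift ord0 j) => //; rewrite liftK.
Qed.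

End FiniteSets.

Lemma card_img (T U : Type) (f : T -> U) (A : set T) n :
  {in A &, injective f} -> A #= `I_n -> f @` A #= `I_n.
Proof. by move=> fi; apply: card_eq_trans; apply: inj_card_eq. Qed.

Lemma card_img_inj (T U : Type) (f : T -> U) (A : set T) n :
  injective f -> f @` A #= `I_n <-> A #= `I_n.
Proof.
move=> fi; have e : f @` A #= A by apply: inj_card_eq => x y _ _; apply: fi.
by split; apply: card_eq_trans => //; apply: card_esym.
Qed.

(** * The beth hierarchy *)

Section Beth.
Variables (I : cardinal) (R : rel I).
Hypothesis Rwo : well_order R.

Definition segment (x : I) : cardinal := {y | below R x y}.

(** The set of z <= y is the segment of y with one more point. *)
Lemma segment_le y X : emb nat X -> emb (segment y) X -> emb {z | R z y} X.
Proof.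
move=> iX yX; apply: emb_trans (emb_option_inf iX yX).
exists (fun z => match pselect (below R y (sval z)) with
  | left h => Some (exist _ _ h) | right _ => None end).
have eqy z : R z y -> ~ below R y z -> z = y.
  by move=> zy nb; apply: contrapT => ne; apply: nb.
move=> [z zy] [z' z'y] /=.
case: pselect => [h|nh]; case: pselect => [h'|nh'] //= e; apply: eq_exist.
  by case: e.
by rewrite (eqy z) // (eqy z').
Qed.

(** If no proper segment of [x] is as large as the infinite X, a copy of X in
    the segment of [x] is cofinal, and the segment of [x] is a union of |X| sets
    of size at most |X|. *)
Lemma segment_bound x X : emb nat X ->
  (forall y, below R x y -> ~ emb X (segment y)) -> emb (segment x) X.
Proof.
move=> iX small; have [//|[f fi]] := emb_total (segment x) X.
have cof (y : segment x) : exists a, R (sval y) (sval (f a)).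
  apply: contrapT => /forallNP h; apply: (small _ (svalP y)).
  have lt a : below R (sval y) (sval (f a)).
    by apply: contrapT => nb; apply: (h a); apply: not_below Rwo _ _ nb.
  by exists (fun a => exist _ _ (lt a)) => a b [] /sig_inj/fi.
have [g gP] := choice cof.
apply: (@emb_trans {a : X & {z | R z (sval (f a))}}).
  exists (fun y => existT (fun a : X => {z | R z (sval (f a))}) (g y)
                     (exist _ (sval y) (gP y))).
  move=> y y' /(congr1 (fun p => sval (tagged p))) /=; exact: sig_inj.
apply: emb_sigma (emb_refl X) _ => // a; apply: segment_le => //.
have [//|/small []] := emb_total (segment (sval (f a))) X.
exact: svalP.
Qed.

(** One and the same recursion at zero, successor and limit points, on the
    pattern of the cumulative hierarchy.  Each stage visibly contains the
    powersets of the previous stages and its own index set; conversely it is no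
    larger than these require, which yields the clauses of the beth
    hierarchy. *)
Definition beth : I -> cardinal :=
  Fix (below_wf Rwo) (fun=> cardinal)
    (fun x rec => (nat + {y : I & {h : below R x y & set (rec y h)}})%type).

Lemma bethE x :
  beth x = (nat + {y : I & {h : below R x y & set (beth y)}})%type.
Proof.
rewrite /beth Fix_eq // => z f g fg; congr (_ + _)%type.
congr (@sigT I); apply: funext => y; congr (@sigT _); apply: funext => h.
by rewrite fg.
Qed.

Lemma nat_beth x : emb nat (beth x).
Proof. by rewrite bethE; exists inl => m n []. Qed.

Lemma pow_beth x y : below R x y -> emb (set (beth y)) (beth x).
Proof.
move=> yx; rewrite [beth x]bethE.
pose F y := {h : below R x y & set (beth y)}.
apply: (@emb_trans (F y)); first by exists (existT _ yx) => A B [].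
apply: (@emb_trans {y : I & F y}); first exact: emb_tag.
by exists inr => p q [].
Qed.

Lemma below_beth x y : below R x y -> emb (beth y) (beth x).
Proof. by move=> yx; apply: emb_trans (pow_beth yx); apply: emb_set1. Qed.

Lemma beth_mono x y : R y x -> emb (beth y) (beth x).
Proof.
move=> yx; have [->|ne] := pselect (y = x); first exact: emb_refl.
exact: below_beth.
Qed.

Lemma segment_beth x : emb (segment x) (beth x).
Proof.
rewrite [beth x]bethE.
exists (fun y : segment x => inr (existT (fun y => {h : below R x y & set (beth y)})
  (sval y)
  (existT (fun _ : below R x (sval y) => set (beth (sval y))) (svalP y) set0))).
by move=> y z [] /sig_inj.
Qed.

Lemma beth_bound x X : emb nat X -> emb (segment x) X ->
  (forall y, below R x y -> emb (set (beth y)) X) -> emb (beth x) X.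
Proof.
move=> iX xX powX; rewrite bethE; apply: emb_sum => //.
apply: (@emb_trans {y : segment x & set (beth (sval y))}).
  exists (fun p => existT (fun y : segment x => set (beth (sval y)))
    (exist _ (tag p) (tag (tagged p))) (tagged (tagged p))).
  move=> [y [h A]] [z [k B]] /= e.
  have /(congr1 sval) /= yz : exist (below R x) y h = exist (below R x) z k.
    exact: (congr1 (@tag _ _) e).
  subst z; have hk := Prop_irrelevance h k; subst k.
  by rewrite (tag_inj e).
by apply: emb_sigma => // y; apply: powX; exact: svalP.
Qed.

Lemma beth_is_hierarchy : beth_hierarchy R beth.
Proof.
split=> [x x0|y x yx|x [nx0 nxS]].
- apply/setT_card_eq; split; last exact: nat_beth.
  have nb y : ~ below R x y by rewrite x0.
  apply: beth_bound; first exact: emb_refl.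
    by exists (fun y => False_rect nat (nb _ (svalP y))) => y; case: (nb _ (svalP y)).
  by move=> y /nb.
- have ltyx : below R x y by rewrite yx; exact: wo_refl.
  apply/setT_card_eq; split; last exact: pow_beth.
  have py : emb (beth y) (set (beth y)) by exact: emb_set1.
  apply: beth_bound; first exact: emb_trans (nat_beth y) py.
    rewrite /segment yx; apply: segment_le.
      exact: emb_trans (nat_beth y) py.
    exact: emb_trans (segment_beth y) py.
  by move=> z; rewrite yx => zy; apply: emb_set; apply: beth_mono.
- split=> [y|mu ub]; first by move=> /below_beth/setT_card_le.
  have {}ub y : below R x y -> emb (beth y) mu by move=> /ub/setT_card_le.
  have [y0 y0x] : exists y, below R x y.
    apply: contrapT => /forallNP n; apply: nx0; apply/seteqP.
    by split=> // y /n.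
  have next y : below R x y -> exists2 z, below R x z & below R z y.
    move=> yx; apply: contrapT => n; apply: (nxS y); apply/seteqP.
    split=> z; last by move=> zy; exact: le_below Rwo _ _ _ zy yx.
    move=> zx; apply: not_below => // yz; apply: n; by exists z.
  (* [mu] also bounds the index set: a segment as large as [mu] would be as large
     as the powerset of some stage that it indexes. *)
  have pow y : below R x y -> emb (set (beth y)) mu.
    by move=> /next[z zx /pow_beth yz]; apply: emb_trans (ub _ zx).
  have natmu : emb nat mu by apply: emb_trans (nat_beth y0) (ub _ y0x).
  apply/setT_card_le; apply: beth_bound => //.
  apply: segment_bound => // y /pow ymu h.
  exact: cantor (emb_trans ymu (emb_trans h (segment_beth y))).
Qed.

Section SuccCardinal.
Variables (kappa : cardinal) (x : I).
Hypothesis kappa_inf : emb nat kappa.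
Hypothesis x_succ : is_succ_cardinal kappa R x.

Lemma segment_succ : ~ emb (segment x) kappa.
Proof. by case: x_succ => /negP n _ /set_card_le. Qed.

Lemma segment_lt_succ y : below R x y -> emb (segment y) kappa.
Proof. by case: x_succ => _ h /h/set_card_le. Qed.

(** The successor cardinal of [kappa] is regular. *)
Lemma succ_unbounded (C : Type) (f : C -> I) : emb C kappa ->
  (forall a, below R x (f a)) -> exists2 y, below R x y & forall a, below R y (f a).
Proof.
move=> Ck fx; apply: contrapT => n; apply: segment_succ.
have cof (y : segment x) : exists a, R (sval y) (f a).
  apply: contrapT => /forallNP h; apply: n; exists (sval y).
    exact: svalP.
  by move=> a; apply: contrapT => nb; apply: (h a); apply: not_below Rwo _ _ nb.
have [g gP] := choice cof.
apply: (@emb_trans {a : C & {z | R z (f a)}}).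
  exists (fun y => existT (fun a : C => {z | R z (f a)}) (g y)
                     (exist _ (sval y) (gP y))).
  move=> y y' /(congr1 (fun p => sval (tagged p))) /=; exact: sig_inj.
apply: emb_sigma => // a; apply: segment_le => //.
exact: segment_lt_succ.
Qed.

Lemma succ_next y : below R x y -> exists2 z, below R x z & below R z y.
Proof.
move=> yx; have [||z zx h] := @succ_unbounded unit (fun=> y).
- by apply: emb_trans kappa_inf; exists (fun=> 0) => -[] [].
- by [].
- by exists z => //; exact: h tt.
Qed.

(** Some segment below [x] has size at least [kappa], since otherwise that of [x]
    would have size at most [kappa]; and every stage is as large as its index
    set. *)
Lemma kappa_beth : exists2 y, below R x y & emb kappa (beth y).
Proof.
apply: contrapT => n; apply: segment_succ; apply: segment_bound => // y yx h.
by apply: n; exists y => //; apply: emb_trans h (segment_beth y).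
Qed.

End SuccCardinal.
End Beth.

(** A well-order of the powerset of [kappa], completed by a last point, is long
    enough to contain the successor cardinal. *)
Lemma ex_succ_cardinal (kappa : cardinal) :
  exists (I : cardinal) (R : rel I) (x : I),
    well_order R /\ is_succ_cardinal kappa R x.
Proof.
have [R0 R0wo] := ex_well_order (set kappa).
pose I : cardinal := option (set kappa).
pose R (a b : I) := match a, b with
  | Some u, Some v => R0 u v | _, None => true | None, Some _ => false end.
have Rwo : well_order R.
  apply: antisymmetric_well_order.
    by move=> [u|] [v|] //= /andP[uv vu]; rewrite (wo_anti R0wo uv vu).
  move=> A [a Aa]; have [[u Au]|n] := pselect (exists u, Some u \in A).
    have [|z Az zmin] := wo_least R0wo (A := [set u | Some u \in A]).
      by exists u.
    by exists (Some z); split=> // -[v /zmin|].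
  exists None; split=> [|[v Av|] //]; last by case: n; exists v.
  by case: a Aa => // v Av; case: n; exists v.
have [|x xk xmin] := wo_min Rwo (P := fun x => ~ emb (segment R x) kappa).
  exists None => h; apply: (@cantor kappa); apply: emb_trans h.
  have b u : below R None (Some u) by [].
  by exists (fun u => exist _ _ (b u)) => u v [].
exists I, R, x; split=> //; split; first by apply/negP => /set_card_le.
by move=> y /xmin/contrapT h; apply/set_card_le.
Qed.

(** * Large colorings have infinite branches *)

(** Colors are indexed by the size minus one, as in diagrams. *)
Definition homog (T C : Type) (c : set T -> C) (w : nat -> C) (S : set T) : Prop :=
  forall k A, A `<=` S -> A #= `I_k.+1 -> c A = w k.

Definition realized (T C : Type) (c : set T -> C) (w : nat -> C) (n : nat) : Prop :=
  exists2 S : set T, S #= `I_n & homog c w S.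

Section EndHomogeneous.
Variables (N C : Type) (R : rel N).
Hypothesis Rwo : well_order R.
Implicit Type c : set N -> C.

Lemma wo_max n (A : set N) : A #= `I_n.+1 ->
  exists2 z, A z & forall u, A u -> R u z.
Proof.
elim: n A => [|n IH] A; first by move=> /card_I1P[x ->]; exists x => // u ->; exact: wo_refl.
move=> /eq_cardSP[x Ax /IH [z [Az nzx] zmax]].
have [xz|zx] := wo_total Rwo x z.
  exists z => // u Au; have [->//|ne] := pselect (u = x); exact: zmax.
exists x => // u Au; have [->|ne] := pselect (u = x); first exact: wo_refl.
by apply: (wo_trans Rwo) zx; apply: zmax.
Qed.

(** The predecessors of [x] in the Erdos-Rado tree of a coloring of X: those
    z < x of X that look like [x] over the smaller predecessors of [x]. *)
Definition pred_of c (X : set N) (x : N) : N -> Prop :=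
  Fix (below_wf Rwo) (fun=> Prop) (fun z rec => [/\ X z, below R x z &
    forall F : set N, (forall u, F u -> exists h : below R z u, rec u h) ->
      c (z |` F) = c (x |` F)]).

Lemma pred_ofE c X x z : pred_of c X x z <-> [/\ X z, below R x z &
    forall F : set N, (forall u, F u -> below R z u /\ pred_of c X x u) ->
      c (z |` F) = c (x |` F)].
Proof.
rewrite {1}/pred_of Fix_eq; last first.
  move=> y f g fg; apply: propext; split=> -[Xy xy h]; split=> // F FP; apply: h.
    by move=> u /FP[k ?]; exists k; rewrite fg.
  by move=> u /FP[k ?]; exists k; rewrite -fg.
split=> -[Xz xz h]; split=> // F FP; apply: h => u /FP.
  by move=> [k ?]; exists k.
by move=> [k ?].
Qed.

(** Otherwise every set of predecessors in the tree has size at most |B|, and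
    [x] is determined by the isomorphism type of its predecessors together with
    the colors of the sets consisting of [x] and some predecessors.  This type
    is coded by a set of pairs and a set of colored subsets of B.  Letting F be
    infinite costs one exponential, but spares the count of the finite sets. *)
Lemma end_homogeneous c (X : set N) (B : Type) :
  emb nat B -> emb C B -> ~ emb {x | X x} (set (set B)) ->
  exists x (Y : set N), [/\ X x, Y `<=` X, ~ emb {y | Y y} B,
     forall y, Y y -> below R x y
   & forall z F, Y z -> F `<=` Y -> (forall u, F u -> below R z u) ->
       c (z |` F) = c (x |` F)].
Proof.
move=> iB CB Xbig; apply: contrapT => noY; apply: Xbig.
pose pre := pred_of c X.
have preX x z : pre x z -> X z by move=> /pred_ofE[].
have preb x z : pre x z -> below R x z by move=> /pred_ofE[].
have prec x z F : pre x z -> (forall u, F u -> below R z u /\ pre x u) ->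
    c (z |` F) = c (x |` F).
  by move=> /pred_ofE[_ _]; apply.
have [b0 _] : exists b : B, True by case: iB => f _; exists (f 0).
have hex (x : N) : exists h : N -> B, X x ->
    forall u v, pre x u -> pre x v -> h u = h v -> u = v.
  have [Xx|nXx] := pselect (X x); last by exists (fun=> b0).
  have : emb {z | pre x z} B.
    apply: contrapT => big; apply: noY; exists x, (pre x); split=> //.
    - exact: preX.
    - exact: preb.
    - by move=> z F pz Fp Fz; apply: prec => // u Fu; split; [apply: Fz|apply: Fp].
  move=> preB; have [h [_ hi]] := emb_extend b0 (emb_trans preB (emb_sigT B)).
  by exists h.
have [h hi] := choice hex.
pose ord x : set (B * B) := [set p | exists z z',
  [/\ pre x z, pre x z', R z z' & p = (h x z, h x z')]].
pose col x : set (set B * C) := [set q | exists2 F, F `<=` pre x &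
  q = (h x @` F, c (x |` F))].
apply: (@emb_trans (set (B * B) * set (set B * C))); last first.
  have iSS : emb nat (set (set B)).
    by apply: emb_trans iB (emb_trans (emb_set1 B) (emb_set1 _)).
  apply: emb_pair => //; apply: emb_set.
    by apply: emb_pair; [exact: emb_trans (emb_set1 B)|exact: emb_set1|exact: emb_set1].
  apply: emb_pair; [exact: emb_trans (emb_set1 B)|exact: emb_refl|].
  exact: emb_trans CB (emb_set1 B).
exists (fun x => (ord (sval x), col (sval x))) => -[x Xx] [x' Xx'] /= [eord ecol].
apply: eq_exist.
(* What the equality of the codes says, in both directions. *)
have order1 y y' : X y -> X y' -> ord y = ord y' -> forall z1 z2 z1' z2',
    pre y z1 -> pre y z2 -> pre y' z1' -> pre y' z2' ->
    h y z1 = h y' z1' -> h y z2 = h y' z2' -> R z1 z2 -> R z1' z2'.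
  move=> Xy Xy' e z1 z2 z1' z2' p1 p2 p1' p2' e1 e2 r.
  have : ord y (h y z1, h y z2) by exists z1, z2.
  rewrite e => -[v1 [v2 [q1 q2 r' [d1 d2]]]].
  have -> : z1' = v1 by apply: (hi _ Xy') => //; rewrite -e1.
  by have -> : z2' = v2 by apply: (hi _ Xy') => //; rewrite -e2.
have match1 y y' : X y -> X y' -> ord y = ord y' -> forall z, pre y z ->
    exists2 z', pre y' z' & h y z = h y' z'.
  move=> Xy Xy' e z pz; have : ord y (h y z, h y z).
    by exists z, z; split=> //; exact: wo_refl.
  by rewrite e => -[v1 [v2 [q1 q2 r' [d1 d2]]]]; exists v1.
have color1 y y' (Q : set N) : X y -> X y' -> col y = col y' ->
    Q `<=` pre y -> Q `<=` pre y' -> (forall u, Q u -> h y u = h y' u) ->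
    forall F, F `<=` Q -> c (y |` F) = c (y' |` F).
  move=> Xy Xy' e Qy Qy' hQ F FQ.
  have : col y (h y @` F, c (y |` F)) by exists F => // u /FQ/Qy.
  rewrite e => -[G Gp [eG ->]]; congr (c (_ |` _)).
  apply/seteqP; split=> u.
    move=> Gu; have : (h y @` F) (h y' u) by rewrite eG; exists u.
    move=> [v Fv e1]; suff -> : u = v by [].
    by apply: (hi _ Xy'); [exact: Gp|exact/Qy'/FQ|rewrite -e1 hQ //; exact: FQ].
  move=> Fu; have : (h y' @` G) (h y u) by rewrite -eG; exists u.
  move=> [v Gv e1]; suff -> : u = v by [].
  by apply: (hi _ Xy'); [exact/Qy'/FQ|exact: Gp|rewrite e1 hQ //; exact: FQ].
(* Two points with the same predecessors Q and the same colors over Q are not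
   comparable: the smaller one would be in Q. *)
have key y y' z z' (Q : set N) : X y -> X y' -> col y = col y' ->
    (forall u, Q u <-> below R z u /\ pre y u) ->
    (forall u, Q u <-> below R z' u /\ pre y' u) ->
    (forall u, Q u -> h y u = h y' u) ->
    X z -> (forall F, F `<=` Q -> c (z |` F) = c (y |` F)) ->
    R z' y' -> ~ below R z' z.
  move=> Xy Xy' ec Qz Qz' hQ Xz cz z'y' zz'.
  have Qy u : Q u -> pre y u by move=> /Qz[].
  have Qy' u : Q u -> pre y' u by move=> /Qz'[].
  have pz : pre y' z.
    apply/pred_ofE; split=> //; first exact: below_le Rwo _ _ _ zz' z'y'.
    move=> F FP; have FQ : F `<=` Q.
      by move=> u /FP[uz pu]; apply/Qz'; split=> //; exact: below_trans Rwo _ _ _ uz zz'.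
    by rewrite cz // (color1 y y' Q).
  have : Q z by apply/Qz'.
  by move=> /Qz[zz _]; exact: below_irr zz.
have fixed z : pre x z -> forall z', pre x' z' -> h x z = h x' z' -> z = z'.
  elim/(well_founded_ind (below_wf Rwo)): z => z IH pz z' pz' e.
  pose Q := [set u | below R z u /\ pre x u].
  have eo y y' w w' u u' : X y -> X y' -> ord y = ord y' ->
      pre y w -> pre y' w' -> h y w = h y' w' -> pre y u -> pre y' u' ->
      h y u = h y' u' -> below R w u -> below R w' u'.
    move=> Xy Xy' eyy' pw pw' ew pu pu' eu [ruw nuw]; split.
      exact: (order1 y y' _ _ eyy' u w).
    move=> euw; apply: nuw; apply: (hi _ Xy) => //; by rewrite eu euw.
  have Q' u : Q u <-> below R z' u /\ pre x' u.
    split=> [[uz pu]|[uz' pu']].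
      have [u' pu' eu] := match1 x x' Xx Xx' eord _ pu.
      have eu' := IH _ uz pu _ pu' eu; rewrite -eu' in pu' eu.
      by split=> //; apply: (eo x x' z z' u u).
    have [v pv ev] := match1 x' x Xx' Xx (esym eord) _ pu'.
    have vz : below R z v by apply: (eo x' x z' z u v).
    by rewrite -(IH _ vz pv _ pu' (esym ev)).
  have hQ u : Q u -> h x u = h x' u.
    move=> [uz pu]; have [u' pu' eu] := match1 x x' Xx Xx' eord _ pu.
    by rewrite eu (IH _ uz pu _ pu' eu).
  have [zz'|//|z'z] := below_tricho Rwo z z'; exfalso.
    apply: (key x' x z' z Q) (zz') => //.
    - by move=> u Qu; rewrite hQ.
    - exact: preX pz'.
    - by move=> F FQ; apply: prec => // u /FQ/Q'.
    - by have [] := preb _ _ pz.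
  apply: (key x x' z z' Q) (z'z) => //.
  - exact: preX pz.
  - by move=> F FQ; apply: prec => // u /FQ.
  - by have [] := preb _ _ pz'.
have presub u : pre x u -> pre x' u /\ h x u = h x' u.
  move=> pu; have [u' pu' eu] := match1 x x' Xx Xx' eord _ pu.
  by have uu' := fixed _ pu _ pu' eu; subst u'.
have presub' u : pre x' u -> pre x u.
  move=> pu; have [u' pu' eu] := match1 x' x Xx' Xx (esym eord) _ pu.
  by rewrite -(fixed _ pu' _ pu (esym eu)).
have Qx u : pre x u <-> below R x u /\ pre x u.
  by split=> [p|[]//]; split=> //; exact: preb.
have Qx' u : pre x u <-> below R x' u /\ pre x' u.
  split=> [/presub[p _]|[_ /presub'] //]; by split=> //; exact: preb.
have [xx'|//|x'x] := below_tricho Rwo x x'; exfalso.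
  apply: (key x' x x' x (pre x)) (xx') => //.
    by move=> u /presub[_ ->].
  exact: wo_refl.
apply: (key x x' x x' (pre x)) (x'x) => //.
  by move=> u /presub[_ ->].
exact: wo_refl.
Qed.

(** The largest element of a subset of [x |` S] can always be replaced by [x]
    without changing the color, so that only the sets containing [x] matter. *)
Lemma homog_cons c x (Y S : set N) (w : nat -> C) :
  (forall z F, Y z -> F `<=` Y -> (forall u, F u -> below R z u) ->
       c (z |` F) = c (x |` F)) ->
  S `<=` Y -> homog (fun F => c (x |` F)) w S ->
  homog c (fun k => if k is j.+1 then w j else c [set x]) (x |` S).
Proof.
move=> Ymin SY hS k A AS Ak.
have cS (F : set N) : F `<=` S -> F #= `I_k ->
    c (x |` F) = if k is j.+1 then w j else c [set x].
  case: k {A AS Ak} => [|k] FS Fk; last exact: hS Fk.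
  by move: Fk => /card_I0P ->; rewrite setU0.
have [Ax|nAx] := pselect (A x).
  have Ak' := card_ID1 Ax Ak; rewrite -(cS _ _ Ak'); last first.
    by move=> u [/AS[->|//]] /(_ erefl).
  congr c; apply/seteqP; split=> u; last by move=> [->|[]].
  by have [->|ne] := pselect (u = x); [left|right].
have {}AS u : A u -> S u 
  by move=> Au; have [e|//] := AS _ Au; case: nAx; rewrite -e.
have [z Az zmax] := wo_max Ak.
have Ak' := card_ID1 Az Ak; rewrite -(cS _ _ Ak'); last by move=> u [/AS].
rewrite -(Ymin z) //; first last.
- by move=> u [Au ne]; split=> //; exact: zmax.
- by move=> u [/AS/SY].
- exact/SY/AS.
congr c; apply/seteqP; split=> u; last by move=> [->|[]].
by have [->|ne] := pselect (u = z); [left|right].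
Qed.

End EndHomogeneous.

(** A coloring with at most [kappa] colors of a set larger than
    beth_{kappa^+} realizes all the finite initial segments of some infinite
    sequence of colors.  A finite sequence s of colors is large if, for every
    y < kappa^+, there are a set of more than beth_y points and an induced
    coloring of it whose homogeneous finite sets give rise to homogeneous sets
    for [c], with the diagram prolonged by s on the left.  The empty sequence is
    large.  Going down from y + 2 to y leaves room for one use of
    end-homogeneity, which adds one color to s; since kappa^+ is regular and
    there are at most [kappa] colors, one of them works for cofinally many y. *)
Lemma infinite_branch (I kappa : cardinal) (R : rel I) (Rwo : well_order R) (x0 : I)
  (N C : Type) (c : set N -> C) :
  emb nat kappa -> is_succ_cardinal kappa R x0 -> emb C kappa ->
  ~ emb N (beth Rwo x0) -> exists w, forall n, realized c w n.
Proof.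
move=> ik x0S Ck Nbig.
have [RN RNwo] := ex_well_order N.
pose splice (s : seq C) (v : nat -> C) i := nth (v (i - size s)) s i.
pose extends s y := exists (X : set N) (c' : set N -> C), ~ emb {a | X a} (beth Rwo y) /\
    forall m v (S : set N), S `<=` X -> S #= `I_m -> homog c' v S ->
      exists2 S' : set N, S' #= `I_(size s + m) & homog c (splice s v) S'.
pose large (s : seq C) := forall y, below R x0 y -> extends s y.
have large0 : large [::].
  move=> y yx0; exists setT, c; split.
    move=> e; apply: Nbig; apply: emb_trans (emb_sigT N) _.
    exact: emb_trans e (below_beth Rwo yx0).
  move=> m v S _ Sm hS; exists S => // k A AS Ak; rewrite /splice nth_nil subn0.
  exact: hS Ak.
have largeS s : large s -> exists u, large (rcons s u).
  move=> Ls; apply: contrapT => /forallNP nu.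
  have fail u : exists y, below R x0 y /\ ~ extends (rcons s u) y.
    apply: contrapT => n; apply: (nu u) => y yx0.
    by apply: contrapT => n'; apply: n; exists y.
  have [f fP] := choice fail.
  have [yk ykx0 kyk] := kappa_beth Rwo ik x0S.
  pose g (o : option C) := if o is Some u then f u else yk.
  have gx0 o : below R x0 (g o) by case: o => [u|] //; have [] := fP u.
  have [y yx0 yf] := succ_unbounded Rwo ik x0S (emb_option_inf ik Ck) gx0.
  have [y1 y1x0 yy1] := succ_next Rwo ik x0S yx0.
  have [y2 y2x0 y12] := succ_next Rwo ik x0S y1x0.
  have [X [c' [Xbig Xc]]] := Ls _ y2x0.
  have [||a [Y [Xa YX Ybig Ya Yc]]] :=
      @end_homogeneous N C RN RNwo c' X (beth Rwo y) (nat_beth Rwo y).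
  - apply: emb_trans Ck (emb_trans kyk _).
    exact: below_beth (yf None).
  - move=> e; apply: Xbig; apply: emb_trans e _.
    by apply: emb_trans (pow_beth Rwo y12); apply: emb_set; apply: pow_beth.
  have [fx0] := fP (c' [set a]); apply; exists Y, (fun F => c' (a |` F)).
  split=> [e|m v S SY Sm hS].
    by apply: Ybig; apply: emb_trans e _; exact: below_beth (yf (Some _)).
  have nSa : ~ S a by move=> Sa; exact: below_irr (Ya _ (SY _ Sa)).
  have aX : a |` S `<=` X by move=> b [->|/SY/YX].
  have [S' S'm hS'] := Xc m.+1 _ _ aX (card_IU1 nSa Sm) (homog_cons RNwo Yc SY hS).
  exists S'; first by rewrite size_rcons addSnnS.
  suff <- : splice s (fun k => if k is j.+1 then v j else c' [set a]) =
         splice (rcons s (c' [set a])) v by [].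
  apply: funext => i; rewrite /splice nth_rcons size_rcons.
  case: ltngtP => [ltis|ltsi|->]; first exact: set_nth_default.
    rewrite nth_default ?(ltnW ltsi) // -subnSK //.
  by rewrite nth_default // subnn.
have [f fP] : exists f, forall s, large s -> large (rcons s (f s)).
  suff /choice[f fP] : forall s, exists u, large s -> large (rcons s u) by exists f.
  move=> s; have [Ls|nLs] := pselect (large s).
    by have [u] := largeS _ Ls; exists u.
  by have [u _] := largeS _ large0; exists u.
pose s n := iter n (fun s => rcons s (f s)) [::].
have Ls n : large (s n) by elim: n => //= n; exact: fP.
have szs n : size (s n) = n by elim: n => //= n; rewrite size_rcons => ->.
exists (fun i => f (s i)) => n.
have sE i u : i < n -> nth u (s n) i = f (s i).
  elim: n => // n IH; rewrite ltnS leq_eqVlt /= nth_rcons szs => /orP[/eqP ->|lt].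
    by rewrite ltnn eqxx.
  by rewrite lt IH.
have [y yx0 _] := kappa_beth Rwo ik x0S.
have [X [c' [_ Xc]]] := Ls n y yx0.
have hom0 : homog c' (fun i => f (s i)) set0.
  by move=> k A A0 /(card_nonempty (ltn0Sn k)) [a /A0].
have [S Sn hS] := Xc 0 _ set0 (@sub0set _ X) ((card_I0P _).2 erefl) hom0.
exists S; first by move: Sn; rewrite szs addn0.
move=> k A AS Ak; rewrite (hS _ _ AS Ak) /splice sE //.
have [m le Am] := card_I_sub AS Sn.
by move: le; rewrite szs addn0 (card_I_inj Am Ak).
Qed.

(** * Colorings without infinite branches below beth_{kappa^+} *)

(** Some coloring with colors in C has a well-founded tree of diagrams. *)
Definition wf_colorable (C X : Type) : Prop :=
  exists c : set X -> C, forall w, exists n, ~ realized c w n.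

Lemma homog_sub (T C : Type) (c : set T -> C) w S S' :
  S' `<=` S -> homog c w S -> homog c w S'.
Proof. by move=> S'S hS k A AS'; apply: hS => x /AS'/S'S. Qed.

Lemma realized_le (T C : Type) (c : set T -> C) w m n :
  m <= n -> realized c w n -> realized c w m.
Proof.
move=> mn [S Sn hS]; have [S' [_ S'S S'm]] :=
  card_between (m := m) (@sub0set _ S) ((card_I0P _).2 erefl) Sn mn.
by exists S' => //; apply: homog_sub hS.
Qed.

Lemma sub_image (T U : Type) (f : T -> U) S A :
  A `<=` f @` S -> exists2 B, B `<=` S & A = f @` B.
Proof.
move=> AS; exists (S `&` f @^-1` A); first by move=> x [].
apply/seteqP; split=> [y Ay|_ [x [_ Ax] <-] //].
by have [x Sx xy] := AS _ Ay; exists x => //; split=> //=; rewrite xy.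
Qed.

Definition at_some (T C : Type) (d : C) (f : T -> C) (A : set T) : C :=
  match pselect (exists x, A x) with
  | left h => f (sval (cid h)) | right _ => d end.

Lemma at_someP T C (d : C) (f : T -> C) A : A !=set0 ->
  exists2 x, A x & at_some d f A = f x.
Proof.
move=> A0; rewrite /at_some; case: pselect => [h|[]//].
by exists (sval (cid h)) => //; exact: svalP (cid h).
Qed.

Lemma at_some1 T C (d : C) (f : T -> C) x : at_some d f [set x] = f x.
Proof. by have [|y -> //] := at_someP d f (A := [set x]); exists x. Qed.

Section WfColorable.
Variables (kappa : Type).
Hypothesis ik : emb nat kappa.

Lemma wf_colorable_emb X Y : emb X Y -> wf_colorable kappa Y -> wf_colorable kappa X.
Proof.
move=> [f fi] [c cP]; exists (fun A => c (f @` A)) => w.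
have [n nr] := cP w; exists n => -[S Sn hS]; apply: nr.
exists (f @` S); first exact/(card_img_inj _ _ fi).
move=> k _ /sub_image[B BS ->] /(card_img_inj _ _ fi); exact: hS.
Qed.

Lemma wf_colorable_small X : emb X kappa -> wf_colorable kappa X.
Proof.
move=> [f fi]; have [e _] := ik.
exists (at_some (e 0) f) => w; exists 2 => -[S /card_I2P[x [y [ne ->]]] hS].
have col z : [set x; y] z -> f z = w 0.
  by move=> Sz; rewrite -(at_some1 (e 0) f z) (hS 0) ?card_set1 // => u ->.
by apply: ne; apply: fi; rewrite !col //; [right|left].
Qed.

(** Coloring the points of the i-th summand by i confines the homogeneous sets
    to one summand. *)
Lemma wf_colorable_sigma J (F : J -> Type) : emb J kappa ->
  (forall j, wf_colorable kappa (F j)) -> wf_colorable kappa {j & F j}.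
Proof.
move=> Jk FP; pose c j := sval (cid (FP j)).
have cP j w : exists n, ~ realized (c j) w n by exact: (svalP (cid (FP j)) w).
have [p pi] : emb (J * kappa) kappa by apply: emb_pair => //; exact: emb_refl.
have [e _] := ik.
pose fib j (A : set {j & F j}) := [set x | A (existT F j x)].
pose c' A := at_some (e 0) (fun a => p (tag a, c (tag a) (fib (tag a) A))) A.
exists c' => w.
have [[[j0 z0] w0]|nw0] := pselect (exists q, p q = w 0); last first.
  exists 1 => -[S /card_I1P[a ->] hS]; apply: nw0.
  have := hS 0 [set a] (@subset_refl _ _) card_set1; rewrite /c'.
  by rewrite at_some1 => <-; eexists.
have [q qK] : exists q : kappa -> J * kappa, cancel p q.
  have h z : exists r, (exists r', p r' = z) -> p r = z.
    have [[r rz]|n] := pselect (exists r', p r' = z); first by exists r.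
    by exists (j0, z0) => /n.
  by have [q qP] := choice h; exists q => r; apply: pi; apply: qP; exists r.
have [n nr] := cP j0 (fun k => (q (w k)).2); exists n.+1 => r; apply: nr.
have {r} [S Sn hS] := r.
have tagS a : S a -> tag a = j0.
  move=> Sa; have := hS 0 [set a]; rewrite /c' at_some1 -w0 => h.
  have aS : [set a] `<=` S by move=> u ->.
  by have [] := pi _ _ (h aS card_set1).
apply: (@realized_le _ _ _ _ _ n.+1) => //.
have Sfib : S = existT F j0 @` fib j0 S.
  apply/seteqP; split=> [[j a] Sa|_ [a Sa <-] //].
  have /= e0 := tagS _ Sa; subst j; by exists a.
have fi := @tag_inj _ F j0.
exists (fib j0 S); first by apply/(card_img_inj _ _ fi); rewrite -Sfib.
move=> k A AS Ak; have Ak' := (card_img_inj A k.+1 fi).2 Ak.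
have AS' : existT F j0 @` A `<=` S by rewrite Sfib; exact: image_subset.
rewrite -(hS _ _ AS' Ak') /c'.
have [_ [a Aa <-] ->] := at_someP (e 0) (fun a => p (tag a, c (tag a)
  (fib (tag a) (existT F j0 @` A)))) (card_nonempty (ltn0Sn k) Ak').
rewrite qK /=; congr (c j0 _); apply/seteqP; split=> x.
  by move=> Ax; exists x.
by move=> [y Ay /fi <-].
Qed.

End WfColorable.

Section Powerset.
Variables (X : Type) (R : rel X).
Hypothesis Rwo : well_order R.
Implicit Types (s t : set X) (A : set (set X)).

Definition first_difference s t (d : X) : Prop :=
  s d <> t d /\ forall u, below R d u -> s u = t u.

Definition differences A : set X :=
  [set d | exists s t, [/\ A s, A t & first_difference s t d]].

Lemma first_difference_uniq s t d d' : first_difference s t d -> first_difference s t d' -> d = d'.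
Proof.
move=> [sd bd] [sd' bd']; have [/bd //|//|/bd' //] := below_tricho Rwo d d'.
Qed.

Lemma first_difference_ex s t u : s u <> t u -> exists2 d, R d u & first_difference s t d.
Proof.
move=> su; have [|d dd dmin] := wo_min Rwo (P := fun d => s d <> t d).
  by exists u.
exists d; last by split=> // v /dmin/contrapT.
by apply: not_below Rwo _ _ _ => /dmin /(_ su).
Qed.

(** Among 2^n sets there is a comb with n + 1 teeth: their first differences form
    a set V of size n, and any k-element subset of V is the set of the first
    differences of k + 1 teeth.  The tree of the given sets forks at their least
    difference d; one side keeps 2^(n-1) sets, in which one finds a smaller
    comb, and any set on the other side is a new tooth. *)
Lemma comb m (a : 'I_m -> set X) (n : nat) (E : {set 'I_m}) :
  injective a -> 2 ^ n <= #|E| ->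
  exists V : set X, [/\ V #= `I_n, V `<=` differences (a @` [set` E])
    & forall U k, U `<=` V -> U #= `I_k -> exists T : {set 'I_m},
        [/\ T \subset E, #|T| = k.+1 & differences (a @` [set` T]) = U]].
Proof.
move=> ai; elim: n E => [|n IH] E.
  rewrite expn0 => /card_gt0P[i iE]; exists set0; split=> //; first exact/card_I0P.
  move=> U k; rewrite subset0 => -> /card_I_inj -/(_ 0 ((card_I0P _).2 erefl)) ->.
  exists [set i]%SET; split; [by rewrite finset.sub1set|exact: cards1|].
  apply/seteqP; split=> // u [_ [_ [[j /set1P -> <-] [j' /set1P -> <-] [ne _]]]].
  exact: ne.
move=> Ecard.
have [i [j [iE jE ij]]] : exists i j, [/\ i \in E, j \in E & i != j].
  have : 1 < #|E|.
    by apply: leq_trans Ecard; rewrite -[1](expn0 2) ltn_exp2l.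
  by move=> /card_gt1P[i [j [? ? ?]]]; exists i, j.
have [d dE dmin] : exists2 d, differences (a @` [set` E]) d &
    forall d', differences (a @` [set` E]) d' -> R d d'.
  apply: wo_least => //; have [u au] : exists u, a i u <> a j u.
    apply: contrapT => /forallNP h; move/eqP: ij; apply; apply: ai.
    by apply: funext => u; apply: contrapT => /h.
  have [d' _ d'P] := first_difference_ex au; exists d', (a i), (a j).
  by split.
have agree i1 i2 u : i1 \in E -> i2 \in E -> below R d u -> a i1 u = a i2 u.
  move=> h1 h2 ud; apply: contrapT => /first_difference_ex[d' d'u d'P].
  apply: (below_notR Rwo ud); apply: (wo_trans Rwo) d'u; apply: dmin.
  by exists (a i1), (a i2); split.
pose side b := [set i in E | `[< a i d >] == b]%SET.
have sideE b i1 : i1 \in side b -> i1 \in E by rewrite inE => /andP[].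
have [b [bcard [x xE xb]]] : exists b, 2 ^ n <= #|side b| /\
    exists2 x, x \in E & x \notin side b.
  have [_ [_ [[i1 i1E <-] [i2 i2E <-] [ne _]]]] := dE.
  have other b : exists2 x, x \in E & x \notin side b.
    apply: contrapT => h; apply: ne.
    have val i3 : i3 \in E -> `[< a i3 d >] = b.
      move=> i3E; apply: contrapT => /eqP n3; apply: h; exists i3 => //.
      by rewrite inE i3E.
    by rewrite -[LHS]asboolE -[RHS]asboolE (val i1) // (val i2).
  have cardE : #|E| = #|side true| + #|side false|.
    rewrite -(cardsID (side true) E); congr (_ + _); apply: eq_card => i3.
      by rewrite !inE; case: (i3 \in E).
    by rewrite !inE; case: (i3 \in E); rewrite //= andbT eqb_id eqbF_neg.
  have [le|lt] := leqP (2 ^ n) #|side true|; first by exists true.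
  exists false; split=> //; rewrite leqNgt; apply/negP => lt'.
  move: Ecard; rewrite cardE leqNgt expnS mul2n -addnn => /negP; apply.
  by rewrite -addnS leq_add // ltnW.
have [V [Vn Vsub Vcomb]] := IH _ bcard.
have mono (E1 E2 : {set 'I_m}) : E1 \subset E2 ->
    differences (a @` [set` E1]) `<=` differences (a @` [set` E2]).
  move=> /fintype.subsetP s12 u [s [t [[i1 /s12 ? <-] [i2 /s12 ? <-] h]]].
  by exists (a i1), (a i2); split.
have bE : side b \subset E by apply/fintype.subsetP => i3; exact: sideE.
have ndV : ~ V d.
  move=> /Vsub[_ [_ [[i1 i1b <-] [i2 i2b <-] [ne _]]]]; apply: ne.
  move: i1b i2b; rewrite /= !inE => /andP[_ /eqP e1] /andP[_ /eqP e2].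
  by rewrite -[LHS]asboolE -[RHS]asboolE e1 e2.
exists (d |` V); split; first exact: card_IU1.
  by move=> u [-> //|/Vsub]; exact: mono.
move=> U k UV Uk; have [Ud|nUd] := pselect (U d); last first.
  have [|T [TE Tk TU]] := Vcomb U k _ Uk.
    by move=> u Uu; have [e|//] := UV _ Uu; case: nUd; rewrite -e.
  by exists T; split=> //; apply: fintype.subset_trans bE.
case: k Uk => [/card_I0P U0|k Uk]; first by move: Ud; rewrite U0.
have [|T [/fintype.subsetP TE Tk TU]] := Vcomb (U `\ d) k _ (card_ID1 Ud Uk).
  by move=> u [/UV[->|//]] /(_ erefl).
have xT : x \notin T by apply: contra xb => /TE.
have fork (t : 'I_m) : t \in T -> first_difference (a x) (a t) d.
  move=> /TE tb; split; last by move=> u; apply: agree => //; exact: sideE tb.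
  move: xb tb; rewrite !inE xE /= => xb /andP[_ /eqP tb] e.
  by move: xb; rewrite -tb e eqxx.
exists (x |: T)%SET; split; last 1 first.
- apply/seteqP; split=> u.
    move=> [_ [_ [[i1 i1T <-] [i2 i2T <-] h]]].
    move: i1T i2T; rewrite /= !inE => /orP[/eqP e1|i1T] /orP[/eqP e2|i2T].
    + by subst i1 i2; case: h.
    + by subst i1; rewrite (first_difference_uniq h (fork _ i2T)).
    + subst i2; suff -> : u = d by [].
      apply: (first_difference_uniq _ (fork _ i1T)); case: h => ne h.
      by split=> [e|v /h ->] //; apply: ne.
    + suff : (U `\ d) u by case.
      by rewrite -TU; exists (a i1), (a i2); split.
  have [->|ne] := pselect (u = d).
    have /card_gt0P[t tT] : 0 < #|T| by rewrite Tk.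
    move=> _; exists (a x), (a t); split; last exact: fork.
      by exists x => //=; rewrite !inE eqxx.
    by exists t => //=; rewrite !inE tT orbT.
  move=> Uu; apply: (mono T); first exact: finset.subsetUr.
  by rewrite TU.
- by rewrite finset.subUset finset.sub1set xE; apply/fintype.subsetP => t /TE/sideE.
- by rewrite cardsU1 xT Tk.
Qed.

End Powerset.

(** A family of subsets of X gets the color of its set of first differences.  A
    homogeneous family of size 2^n contains a comb, whose first differences form
    a homogeneous subset of X of size n, with the diagram shifted by one. *)
Lemma wf_colorable_set kappa X : wf_colorable kappa X -> wf_colorable kappa (set X).
Proof.
move=> [c cP]; have [R Rwo] := ex_well_order X.
exists (fun A => c (differences R A)) => w.
have [n nr] := cP (fun k => w k.+1); exists (2 ^ n) => -[S Sn hS]; apply: nr.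
have [a [ai ar]] := card_enum Sn.
have [|V [Vn _ Vcomb]] := comb Rwo (n := n) (E := [set: 'I_(2 ^ n)]%SET) ai.
  by rewrite cardsT card_ord.
exists V => // k U UV Uk; have [T [_ Tk <-]] := Vcomb _ _ UV Uk.
apply: hS; first by rewrite -ar => _ [i _ <-]; exists i.
rewrite -Tk (_ : a @` [set` T] = range (a \o (@enum_val _ (mem T)))).
  by apply: card_range; apply: inj_comp ai (@enum_val_inj _ _).
apply/seteqP; split=> _ [i iT <-]; last by exists (enum_val i) => //; exact: enum_valP.
by exists (enum_rank_in iT i) => //=; rewrite enum_rankK_in.
Qed.

(** A stage below kappa^+ is a sum of at most [kappa] powersets of previous
    stages. *)
Lemma wf_colorable_beth (kappa I : cardinal) (R : rel I) (Rwo : well_order R) (x y : I) :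
  emb nat kappa -> is_succ_cardinal kappa R x -> below R x y ->
  wf_colorable kappa (beth Rwo y).
Proof.
move=> ik xS; elim/(well_founded_ind (below_wf Rwo)): y => y IH yx.
pose F (o : option (segment R y)) : Type :=
  if o is Some z then set (beth Rwo (sval z)) else nat.
apply: (@wf_colorable_emb _ _ {o & F o}).
  rewrite bethE.
  exists (fun s : nat + {z : I & {h : below R y z & set (beth Rwo z)}} =>
    match s with inl n => existT F None n | inr (existT z (existT h A)) =>
      existT F (Some (exist _ z h)) A end).
  move=> [n|[z [h A]]] [n'|[z' [h' A']]] /=.
  - by move=> e; congr inl; exact: (tag_inj e).
  - by move=> /(congr1 (@tag _ _)).
  - by move=> /(congr1 (@tag _ _)).
  - move=> e; have /= [zz'] := congr1 (@tag _ _) e.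
    subst z'; have hh' := Prop_irrelevance h h'; subst h'.
    by have /= AA' := tag_inj e; subst A'.
apply: wf_colorable_sigma => //.
  by apply: emb_option_inf => //; apply: segment_lt_succ yx.
move=> [[z zy]|]; last exact: wf_colorable_small.
by apply: wf_colorable_set; apply: IH => //; exact: (below_trans Rwo zy yx).
Qed.

(** * Coloring classes in terms of colorings *)

Section Models.
Variable L : language.

Definition has_arity (T : Type) (c : set T -> L) : Prop :=
  forall n A, 0 < n -> A #= `I_n -> arity (c A) = n.

Definition model (W : allowed_diagrams L) (T : Type) (c : set T -> L) : Prop :=
  has_arity c /\
  forall n (S : set T) (d : 'I_n -> L), S #= `I_n -> is_diagram c S d -> W n d.

Definition color_emb (T U : Type) (c : set T -> L) (c' : set U -> L) (f : T -> U) :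
    Prop :=
  injective f /\ forall n A, 0 < n -> A #= `I_n -> c' (f @` A) = c A.

(** The parameter [D] asks for disjointness, so that amalgamation and disjoint
    amalgamation are the cases where it is [False] and [True]. *)
Definition amalgam (D : Prop) (W : allowed_diagrams L) (T0 T1 T2 : cardinal)
    (c1 : set T1 -> L) (c2 : set T2 -> L) (g1 : T0 -> T1) (g2 : T0 -> T2) : Prop :=
  exists (N : cardinal) (c : set N -> L) (f1 : T1 -> N) (f2 : T2 -> N),
    [/\ model W c, color_emb c1 c f1, color_emb c2 c f2,
        forall m, f1 (g1 m) = f2 (g2 m)
      & D -> forall a b, f1 a = f2 b -> exists2 m, a = g1 m & b = g2 m].

Definition amalgamates (D : Prop) (W : allowed_diagrams L) (mu : cardinal) : Prop :=
  forall (T0 T1 T2 : cardinal) (c0 : set T0 -> L) (c1 : set T1 -> L)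
    (c2 : set T2 -> L) (g1 : T0 -> T1) (g2 : T0 -> T2),
    model W c0 -> model W c1 -> model W c2 ->
    [set: T0] #= [set: mu] -> [set: T1] #= [set: mu] -> [set: T2] #= [set: mu] ->
    color_emb c0 c1 g1 -> color_emb c0 c2 g2 -> amalgam D W c1 c2 g1 g2.

Definition struct_of (T : cardinal) (c : set T -> L) : structure L :=
  @Structure L T (fun P a => injective a /\ c (range a) = P).

Lemma struct_of_coloring (T : cardinal) (c : set T -> L) :
  has_arity c -> is_coloring (M := struct_of c) c.
Proof.
move=> ar; split=> //; last by move=> P a [].
by move=> P a ai; split=> [|[]].
Qed.

Lemma diagram_monochromatic (T : Type) (c : set T -> L) n (S : set T) (d : 'I_n -> L) :
  S #= `I_n -> is_diagram c S d -> monochromatic c S.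
Proof.
move=> Sn Sd [//|k] B C _ BS CS Bk Ck.
have [m mn Bm] := card_I_sub BS Sn; rewrite (card_I_inj Bm Bk) in mn.
by rewrite (Sd (Ordinal mn) B BS Bk) (Sd (Ordinal mn) C CS Ck).
Qed.

Lemma coloring_classP (W : allowed_diagrams L) (N : structure L) :
  coloring_class W N <-> exists2 c : set N -> L, is_coloring c & model W c.
Proof.
split=> [[c [cc cW]]|[c cc [_ cW]]].
  exists c => //; split; first by case: cc.
  by move=> n S d Sn Sd; apply: (cW _ _ _ Sn) => //; exact: diagram_monochromatic Sd.
by exists c; split=> // n S d Sn _; exact: cW.
Qed.

Lemma embedding_colorP (M N : structure L) (cM : set M -> L) (cN : set N -> L)
    (f : M -> N) : is_coloring cM -> is_coloring cN ->
  embedding f <-> color_emb cM cN f.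
Proof.
move=> [arM hM iM] [arN hN iN].
have imf n (a : 'I_n -> M) : range (f \o a) = f @` range a.
  by rewrite image_comp.
split=> -[fi fh]; split=> //.
  move=> n A n0 An; have An' : A #= `I_(arity (cM A)) by rewrite (arM n).
  have [a [ai ar]] := card_enum An'.
  have ha : holds a by apply/hM => //; rewrite ar.
  have hfa := (fh _ _).1 ha.
  by have := (hN _ _ (iN _ _ hfa)).2 hfa; rewrite imf ar.
have cE P (a : 'I_(arity P) -> M) : injective a ->
    cN (range (f \o a)) = cM (range a).
  by move=> ai; rewrite imf (fh (arity P)) ?arity_gt0 //; exact: card_range.
move=> P a; split=> [ha|hfa].
  have ai := iM _ _ ha; apply/hN; first exact: inj_comp.
  by rewrite cE //; apply/hM.
have fai := iN _ _ hfa.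
have ai : injective a by move=> x y e; apply: fai; rewrite /= e.
by apply/hM => //; rewrite -cE //; apply/hN.
Qed.

Lemma amalgam_structP (D : Prop) (W : allowed_diagrams L)
    (M0 : cardinal) (M1 M2 : structure L) (c1 : set M1 -> L) (c2 : set M2 -> L)
    (g1 : M0 -> M1) (g2 : M0 -> M2) : is_coloring c1 -> is_coloring c2 ->
  (exists (N : structure L) (f1 : M1 -> N) (f2 : M2 -> N),
    [/\ coloring_class W N, embedding f1, embedding f2, f1 \o g1 = f2 \o g2
      & D -> range f1 `&` range f2 = range (f1 \o g1)]) <->
  amalgam D W c1 c2 g1 g2.
Proof.
move=> k1 k2; split.
  move=> [N [f1 [f2 [/coloring_classP[c kN mN] ef1 ef2 fg fd]]]].
  have fgm m : f1 (g1 m) = f2 (g2 m) by exact: (congr1 (fun h => h m) fg).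
  exists N, c, f1, f2; split=> //; [exact/embedding_colorP|exact/embedding_colorP|].
  move=> /fd fI a b fab; have : (range f1 `&` range f2) (f1 a).
    by split; [exists a|exists b].
  rewrite fI => -[m _ /= /(ef1.1) ma]; exists m => //.
  by apply: (ef2.1); rewrite -fab -ma.
move=> [N [c [f1 [f2 [mN ef1 ef2 fg fd]]]]].
have kN := struct_of_coloring mN.1.
exists (struct_of c), f1, f2; split.
- by apply/coloring_classP; exists c.
- exact/(embedding_colorP _ k1 kN).
- exact/(embedding_colorP _ k2 kN).
- exact: funext.
- move=> /fd fI; apply/seteqP; split=> z.
    by move=> [[a _ <-] [b _ /esym /fI[m -> _]]]; exists m.
  by move=> [m _ <-]; split; [exists (g1 m)|exists (g2 m); rewrite //= fg].
Qed.

Lemma amalgamates_structP (D : Prop) (W : allowed_diagrams L) (mu : cardinal) :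
  (forall (M0 M1 M2 : structure L) (g1 : M0 -> M1) (g2 : M0 -> M2),
    coloring_class W M0 -> coloring_class W M1 -> coloring_class W M2 ->
    has_card M0 mu -> has_card M1 mu -> has_card M2 mu ->
    embedding g1 -> embedding g2 ->
    exists (N : structure L) (f1 : M1 -> N) (f2 : M2 -> N),
      [/\ coloring_class W N, embedding f1, embedding f2, f1 \o g1 = f2 \o g2
        & D -> range f1 `&` range f2 = range (f1 \o g1)]) <->
  amalgamates D W mu.
Proof.
split=> AP.
- move=> T0 T1 T2 c0 c1 c2 g1 g2 m0 m1 m2 e0 e1 e2 eg1 eg2.
  have k0 := struct_of_coloring m0.1.
  have k1 := struct_of_coloring m1.1.
  have k2 := struct_of_coloring m2.1.
  apply/(amalgam_structP D W _ _ k1 k2).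
  apply: (AP (struct_of c0) (struct_of c1) (struct_of c2) g1 g2) => //.
  + by apply/coloring_classP; exists c0.
  + by apply/coloring_classP; exists c1.
  + by apply/coloring_classP; exists c2.
  + exact/(embedding_colorP _ k0 k1).
  + exact/(embedding_colorP _ k0 k2).
- move=> M0 M1 M2 g1 g2 /coloring_classP[c0 k0 m0] /coloring_classP[c1 k1 m1].
  move=> /coloring_classP[c2 k2 m2] e0 e1 e2 eg1 eg2.
  apply/(amalgam_structP D W _ _ k1 k2); apply: (AP _ _ _ c0) => //.
  + exact/embedding_colorP.
  + exact/embedding_colorP.
Qed.

Lemma amalgamationP (W : allowed_diagrams L) mu :
  amalgamation (StructClass (coloring_class W)) mu <-> amalgamates False W mu.
Proof.
apply: iff_trans (amalgamates_structP False W mu); split=> AP M0 M1 M2 g1 g2 *.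
  by have [||||||||N [f1 [f2 []]]] := AP M0 M1 M2 g1 g2 => //; exists N, f1, f2.
by have [||||||||N [f1 [f2 []]]] := AP M0 M1 M2 g1 g2 => //; exists N, f1, f2.
Qed.

Lemma disjoint_amalgamationP (W : allowed_diagrams L) mu :
  disjoint_amalgamation (StructClass (coloring_class W)) mu <->
  amalgamates True W mu.
Proof.
apply: iff_trans (amalgamates_structP True W mu); split=> AP M0 M1 M2 g1 g2 *.
  by have [||||||||N [f1 [f2 []]]] := AP M0 M1 M2 g1 g2 => //; exists N, f1, f2.
have [||||||||N [f1 [f2 [? ? ? ? fI]]]] := AP M0 M1 M2 g1 g2 => //.
by exists N, f1, f2; split=> //; exact: fI.
Qed.

End Models.

(** * Amalgamating one color of points at a time *)

Section Amalgams.
Variables (L : language) (W : allowed_diagrams L).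

Definition branch (w : nat -> L) : Prop := forall n, W n (fun k : 'I_n => w k).

Lemma branch_arity w k : branch w -> arity (w k) = k.+1.
Proof. by move=> bw; exact: (allowed_arity (bw k.+1) ord_max). Qed.

Lemma allowed0 (d : 'I_0 -> L) : W 0 d.
Proof.
have [n [w Ww]] := allowed_nonempty W.
have -> : d = fun k : 'I_0 => w (widen_ord (leq0n n) k) by apply: funext => -[].
exact: allowed_restr.
Qed.

Lemma ex_symbol_of (T : Type) : exists s : set T -> L, has_arity s.
Proof.
have h (A : set T) : exists P : L, forall n, 0 < n -> A #= `I_n -> arity P = n.
  have [[n [n0 An]]|no] := pselect (exists n, 0 < n /\ A #= `I_n).
    have [P aP] := arity_surj L n0; exists P => m _ Am.
    by rewrite aP; exact: card_I_inj An Am.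
  have [P _] := arity_surj L (ltn0Sn 0); exists P => n n0 An.
  by case: no; exists n.
by have [s sP] := choice h; exists s => n A; exact: sP.
Qed.

Lemma ex_size_of (T : Type) : exists sz : set T -> nat,
  forall k A, A #= `I_k.+1 -> sz A = k.
Proof.
have h (A : set T) : exists n, forall k, A #= `I_k.+1 -> n = k.
  have [[n An]|no] := pselect (exists n, A #= `I_n.+1).
    by exists n => k Ak; have [] := card_I_inj An Ak.
  by exists 0 => k Ak; case: no; exists k.
by have [s sP] := choice h; exists s => k A; exact: sP.
Qed.

Lemma model_pull (T T' : Type) (c : set T -> L) (h : T' -> T) :
  injective h -> model W c -> model W (fun A => c (h @` A)).
Proof.
move=> hi [ar dg]; split=> [n A n0 An|n S d Sn Sd].
  by apply: ar => //; exact/card_img_inj.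
apply: (dg n (h @` S)); first exact/card_img_inj.
move=> k _ /sub_image[B BS ->] /(card_img_inj _ _ hi); exact: Sd.
Qed.

Lemma diagram_pull (T N : Type) (c : set T -> L) (c' : set N -> L) f n
    (S : set N) (d : 'I_n -> L) : model W c -> color_emb c c' f ->
  S #= `I_n -> S `<=` range f -> is_diagram c' S d -> W n d.
Proof.
move=> [_ dg] [fi fc] Sn /sub_image[S1 _ S1E] Sd; subst S.
move/(card_img_inj _ _ fi) in Sn; apply: dg Sn _ => k B BS Bk.
rewrite -(fc k.+1) //; apply: Sd; first exact: image_subset.
exact/card_img_inj.
Qed.

Lemma diagram_points (T : Type) (c : set T -> L) n (S : set T) (d : 'I_n.+1 -> L) z :
  is_diagram c S d -> S z -> c [set z] = d ord0.
Proof. by move=> Sd Sz; apply: Sd; [move=> u ->|exact: card_set1]. Qed.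

Lemma color_emb1 (T N : Type) (c : set T -> L) (c' : set N -> L) f a :
  color_emb c c' f -> c' [set f a] = c [set a].
Proof. by move=> [_ fc]; rewrite -(fc 1) ?image_set1 //; exact: card_set1. Qed.

Lemma pushout (T0 T1 T2 : cardinal) (g1 : T0 -> T1) (g2 : T0 -> T2) :
  injective g1 -> injective g2 ->
  exists (N : cardinal) (f1 : T1 -> N) (f2 : T2 -> N),
  [/\ injective f1, injective f2, forall m, f1 (g1 m) = f2 (g2 m),
      forall z, (exists a, f1 a = z) \/ (exists b, f2 b = z)
    & forall a b, f1 a = f2 b -> exists2 m, a = g1 m & b = g2 m].
Proof.
move=> g1i g2i.
exists (T1 + {b : T2 | ~ exists m, g2 m = b})%type, inl.
exists (fun b => match pselect (exists m, g2 m = b) with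
  | left h => inl (g1 (sval (cid h))) | right n => inr (exist _ b n) end).
split=> [a a' []//|b b'|m|z|a b].
- case: pselect => h; case: pselect => h' //= -[].
    move=> /g1i e; rewrite -(svalP (cid h)) -(svalP (cid h')); by rewrite e.
  by [].
- case: pselect => [h|[]]; last by exists m.
  by congr (inl (g1 _)); apply: g2i; rewrite (svalP (cid h)).
- case: z => [a|[b nb]]; first by left; exists a.
  by right; exists b; case: pselect => // n; congr inr; apply: eq_exist.
- case: pselect => // h [->]; exists (sval (cid h)) => //.
  by rewrite (svalP (cid h)).
Qed.

Lemma union_coloring (T0 T1 T2 N : Type) (c0 : set T0 -> L)
    (c1 : set T1 -> L) (c2 : set T2 -> L) (g1 : T0 -> T1) (g2 : T0 -> T2)
    (f1 : T1 -> N) (f2 : T2 -> N) (s : set N -> L) :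
  injective f1 -> injective f2 -> (forall m, f1 (g1 m) = f2 (g2 m)) ->
  (forall a b, f1 a = f2 b -> exists2 m, a = g1 m & b = g2 m) ->
  color_emb c0 c1 g1 -> color_emb c0 c2 g2 ->
  exists c : set N -> L, [/\ color_emb c1 c f1, color_emb c2 c f2
    & forall A, ~ A `<=` range f1 -> ~ A `<=` range f2 -> c A = s A].
Proof.
move=> f1i f2i fg fI e1 e2.
pose c (A : set N) := match pselect (exists A1, A = f1 @` A1) with
  | left h => c1 (sval (cid h)) | right _ =>
  match pselect (exists A2, A = f2 @` A2) with
  | left h => c2 (sval (cid h)) | right _ => s A end end.
have cf1 A : c (f1 @` A) = c1 A.
  rewrite /c; case: pselect => [h|[]]; last by exists A.
  by congr c1; apply: (image_set_inj f1i); rewrite -(svalP (cid h)).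
have cf2 n A : 0 < n -> A #= `I_n -> c (f2 @` A) = c2 A.
  move=> n0 An; rewrite /c; case: pselect => h.
    case: (cid h) => A1 E /=.
    pose A0 := g1 @^-1` A1.
    have E1 : A1 = g1 @` A0.
      apply/seteqP; split=> [a A1a|_ [m ? <-] //].
      have : (f2 @` A) (f1 a) by rewrite E; exists a.
      by move=> [b _ /esym/fI[m am _]]; exists m; rewrite /A0 /= -?am.
    have E2 : A = g2 @` A0.
      apply: (image_set_inj f2i); rewrite E {1}E1 !image_comp.
      by rewrite (_ : f1 \o g1 = f2 \o g2) //; apply: funext.
    have A0n : A0 #= `I_n by move: An; rewrite E2 => /(card_img_inj _ _ e2.1).
    by rewrite E1 E2 (e1.2 n) // (e2.2 n).
  case: pselect => [h'|[]]; last by exists A.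
  by congr c2; apply: (image_set_inj f2i); rewrite -(svalP (cid h')).
exists c; split; [by split=> // n A _ _; exact: cf1|by split=> // n A; exact: cf2|].
move=> A n1 n2; rewrite /c; case: pselect => [[A1 e]|_].
  by case: n1; rewrite e => _ [a _ <-]; exists a.
case: pselect => [[A2 e]|//].
by case: n2; rewrite e => _ [a _ <-]; exists a.
Qed.

(** In a color [w 0] that starts an infinite branch [w] of allowed diagrams,
    all the sets that are not contained in one of the two models may be colored
    along [w]. *)
Lemma amalgam_branch (w : nat -> L) (T0 T1 T2 : cardinal) (c0 : set T0 -> L)
    (c1 : set T1 -> L) (c2 : set T2 -> L) (g1 : T0 -> T1) (g2 : T0 -> T2) :
  branch w -> model W c1 -> model W c2 -> color_emb c0 c1 g1 -> color_emb c0 c2 g2 ->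
  (forall a, c1 [set a] = w 0) -> (forall b, c2 [set b] = w 0) ->
  amalgam True W c1 c2 g1 g2.
Proof.
move=> bw m1 m2 eg1 eg2 w1 w2.
have [N [f1 [f2 [f1i f2i fg fU fI]]]] := pushout eg1.1 eg2.1.
have [sz szE] := ex_size_of N.
have [c [e1 e2 cw']] := union_coloring (fun A => w (sz A)) f1i f2i fg fI eg1 eg2.
have cw A k : ~ A `<=` range f1 -> ~ A `<=` range f2 -> A #= `I_k.+1 -> c A = w k.
  by move=> n1 n2 Ak; rewrite cw' // (szE k).
exists N, c, f1, f2; split=> //; split=> [[//|n] A _ An|n S d Sn Sd].
  have [/sub_image[A1 _ AE]|n1] := pselect (A `<=` range f1).
    move: An; rewrite AE => /(card_img_inj _ _ f1i) An.
    by rewrite (e1.2 n.+1) //; apply: m1.1.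
  have [/sub_image[A2 _ AE]|n2] := pselect (A `<=` range f2).
    move: An; rewrite AE => /(card_img_inj _ _ f2i) An.
    by rewrite (e2.2 n.+1) //; apply: m2.1.
  by rewrite (cw A n) // branch_arity.
have [s1|n1] := pselect (S `<=` range f1); first exact: diagram_pull m1 e1 Sn s1 Sd.
have [s2|n2] := pselect (S `<=` range f2); first exact: diagram_pull m2 e2 Sn s2 Sd.
have [x [Sx nx]] : exists x, S x /\ ~ range f1 x.
  by apply: contrapT => h; apply: n1 => x Sx; apply: contrapT => nx; apply: h; exists x.
have [y [Sy ny]] : exists y, S y /\ ~ range f2 y.
  by apply: contrapT => h; apply: n2 => y Sy; apply: contrapT => ny; apply: h; exists y.
have xy : x <> y.
  by move=> e; subst y; have [[a ax]|[b bx]] := fU x; [apply: nx; exists a|apply: ny; exists b].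
suff -> : d = fun k : 'I_n => w k by [].
apply: funext => k; have xyS : [set x; y] `<=` S by move=> u [->|->].
have [k0|k0] := posnP k.
  have [a fay] : exists a, f1 a = y.
    by have [//|[b by_]] := fU y; case: ny; exists b.
  rewrite -(Sd k [set y]) ?k0; last exact: card_set1.
    by rewrite -fay (color_emb1 _ e1).
  by move=> u ->.
have [C [xyC CS Ck]] := card_between (m := k.+1) xyS (card_I2 xy) Sn
   (introT andP (conj k0 (ltn_ord k))).
rewrite -(Sd k C CS Ck) (cw C k) // => h; [apply: nx|apply: ny]; apply: h; apply: xyC.
  by left.
by right.
Qed.

Definition of_color (T : Type) (c : set T -> L) (P : L) : cardinal :=
  {a : T | c [set a] = P}.

(** The homogeneous sets lie within one color of points, and the colors of
    the other sets are arbitrary.  Hence disjoint amalgams can be found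
    separately for the points of each color. *)
Lemma amalgam_glue (T0 T1 T2 : cardinal) (c0 : set T0 -> L)
    (c1 : set T1 -> L) (c2 : set T2 -> L) (g1 : T0 -> T1) (g2 : T0 -> T2)
    (e1 : color_emb c0 c1 g1) (e2 : color_emb c0 c2 g2) :
  model W c1 -> model W c2 ->
  (forall P, amalgam True W (fun A : set (of_color c1 P) => c1 (sval @` A))
     (fun A : set (of_color c2 P) => c2 (sval @` A))
     (fun m : of_color c0 P =>
        exist (fun a => c1 [set a] = P) (g1 (sval m)) (etrans (color_emb1 _ e1) (svalP m)))
     (fun m : of_color c0 P =>
        exist (fun a => c2 [set a] = P) (g2 (sval m)) (etrans (color_emb1 _ e2) (svalP m)))) ->
  amalgam True W c1 c2 g1 g2.
Proof.
move=> m1 m2 loc.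
have [N [f1 [f2 [f1i f2i fg fU fI]]]] := pushout e1.1 e2.1.
have [pc pcP] : exists pc : N -> L, forall z,
    (forall a, f1 a = z -> c1 [set a] = pc z) /\
    (forall b, f2 b = z -> c2 [set b] = pc z).
  suff /choice[pc pcP] : forall z, exists P, (forall a, f1 a = z -> c1 [set a] = P) /\
    (forall b, f2 b = z -> c2 [set b] = P) by exists pc.
  move=> z; have [[a az]|[b bz]] := fU z.
    exists (c1 [set a]); split=> [a'|b]; rewrite -az; first by move=> /f1i ->.
    by move=> /esym/fI[m -> ->]; rewrite (color_emb1 _ e1) (color_emb1 _ e2).
  exists (c2 [set b]); split=> [a|b']; rewrite -bz; last by move=> /f2i ->.
  by move=> /fI[m -> ->]; rewrite (color_emb1 _ e1) (color_emb1 _ e2).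
have pc1 a : pc (f1 a) = c1 [set a] by have [/(_ a erefl)] := pcP (f1 a).
have pc2 b : pc (f2 b) = c2 [set b] by have [_ /(_ b erefl)] := pcP (f2 b).
(* The amalgam for the color P, transported to the points of N of color P. *)
have [cP cPP] : exists cP : L -> set N -> L, forall P,
   [/\ forall n A, 0 < n -> A #= `I_n -> (forall z, A z -> pc z = P) -> arity (cP P A) = n,
       forall n A, 0 < n -> A #= `I_n -> (forall a, A a -> c1 [set a] = P) ->
         cP P (f1 @` A) = c1 A,
       forall n A, 0 < n -> A #= `I_n -> (forall a, A a -> c2 [set a] = P) ->
         cP P (f2 @` A) = c2 A
     & forall n S (d : 'I_n -> L), S #= `I_n -> (forall z, S z -> pc z = P) ->
         is_diagram (cP P) S d -> W n d].
  suff /choice[cP cPP] : forall P, exists cP : set N -> L,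
   [/\ forall n A, 0 < n -> A #= `I_n -> (forall z, A z -> pc z = P) -> arity (cP A) = n,
       forall n A, 0 < n -> A #= `I_n -> (forall a, A a -> c1 [set a] = P) ->
         cP (f1 @` A) = c1 A,
       forall n A, 0 < n -> A #= `I_n -> (forall a, A a -> c2 [set a] = P) ->
         cP (f2 @` A) = c2 A
     & forall n S (d : 'I_n -> L), S #= `I_n -> (forall z, S z -> pc z = P) ->
         is_diagram cP S d -> W n d] by exists cP.
  move=> P; have [N' [c' [h1 [h2 [mN' eh1 eh2 hg hI]]]]] := loc P.
  pose m1' := fun m : of_color c0 P =>
    exist (fun a => c1 [set a] = P) (g1 (sval m)) (etrans (color_emb1 _ e1) (svalP m)).
  pose m2' := fun m : of_color c0 P =>
    exist (fun a => c2 [set a] = P) (g2 (sval m)) (etrans (color_emb1 _ e2) (svalP m)).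
  have [s sar] := ex_symbol_of N.
  have [[z0 z0P]|noP] := pselect (exists z, pc z = P); last first.
    have noP' (A : set N) n : 0 < n -> A #= `I_n -> (forall z, A z -> pc z = P) -> False.
      by move=> n0 /(card_nonempty n0)[z Az] AP; apply: noP; exists z; exact: AP.
    exists s; split=> [n A n0 An _|n A n0 An AP|n A n0 An AP|n S d Sn SP _].
    - exact: sar.
    - case: (noP' (f1 @` A) n) => //; first exact/card_img_inj.
      by move=> _ [a /AP aP <-]; rewrite pc1.
    - case: (noP' (f2 @` A) n) => //; first exact/card_img_inj.
      by move=> _ [a /AP aP <-]; rewrite pc2.
    - case: n d Sn => [|n] d Sn; first exact: allowed0.
      by case: (noP' _ _ _ Sn).
  have fU' z : pc z = P -> (exists x : of_color c1 P, f1 (sval x) = z) \/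
      (exists x : of_color c2 P, f2 (sval x) = z).
    move=> zP; have [[a az]|[b bz]] := fU z.
      have aP : c1 [set a] = P by rewrite -pc1 az.
      by left; exists (exist _ a aP).
    have bP : c2 [set b] = P by rewrite -pc2 bz.
    by right; exists (exist _ b bP).
  have fI' (x : of_color c1 P) (y : of_color c2 P) : f1 (sval x) = f2 (sval y) ->
      h1 x = h2 y.
    move=> /fI[m xm ym]; have mP : c0 [set m] = P.
      by rewrite -(color_emb1 m e1) -xm; exact: (svalP x).
    have -> : x = m1' (exist _ m mP) by apply: sig_inj.
    have -> : y = m2' (exist _ m mP) by apply: sig_inj.
    exact: hg.
  have [phi phi1 phi2] : exists2 phi : N -> N',
      (forall x : of_color c1 P, phi (f1 (sval x)) = h1 x) &
      (forall x : of_color c2 P, phi (f2 (sval x)) = h2 x).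
    have [y0 _] : exists y : N', True.
      by have [[x _]|[x _]] := fU' _ z0P; [exists (h1 x)|exists (h2 x)].
    suff /choice[phi phiP] : forall z, exists y,
        (forall x : of_color c1 P, f1 (sval x) = z -> h1 x = y) /\
        (forall x : of_color c2 P, f2 (sval x) = z -> h2 x = y).
      by exists phi => x; symmetry; [apply: (phiP _).1|apply: (phiP _).2].
    move=> z; have [[x xz]|nx] := pselect (exists x : of_color c1 P, f1 (sval x) = z).
      exists (h1 x); split=> y; rewrite -xz => e; last by rewrite (fI' x y).
      by congr h1; apply: sig_inj; apply: f1i.
    have [[x xz]|nx'] := pselect (exists x : of_color c2 P, f2 (sval x) = z).
      exists (h2 x); split=> y; first by move=> yz; case: nx; exists y.
      by rewrite -xz => e; congr h2; apply: sig_inj; apply: f2i.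
    by exists y0; split=> x xz; [case: nx; exists x|case: nx'; exists x].
  have phiI u v : pc u = P -> pc v = P -> phi u = phi v -> u = v.
    have cross (x : of_color c1 P) (y : of_color c2 P) : h1 x = h2 y ->
        f1 (sval x) = f2 (sval y).
      by move=> /(hI I)[m -> ->]; exact: fg.
    move=> /fU'[[x <-]|[x <-]] /fU'[[y <-]|[y <-]]; rewrite ?phi1 ?phi2.
    - by move=> /(eh1.1) ->.
    - exact: cross.
    - by move=> /esym/cross.
    - by move=> /(eh2.1) ->.
  have phiA (S : set N) : (forall z, S z -> pc z = P) -> {in S &, injective phi}.
    by move=> SP u v /set_mem Su /set_mem Sv; apply: phiI; exact: SP.
  exists (fun A => c' (phi @` A)); split=> [n A n0 An AP|n A n0 An AP|n A n0 An AP|].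
  - by apply: mN'.1 => //; apply: card_img An; exact: phiA.
  - pose A' := [set x : of_color c1 P | A (sval x)].
    have AE : A = sval @` A'.
      apply/seteqP; split=> [a Aa|_ [x Ax <-] //].
      by exists (exist _ a (AP _ Aa)).
    have An' : A' #= `I_n by move: An; rewrite {1}AE; move/(card_img_inj _ _ (@sig_inj _ _)).
    have := eh1.2 n A' n0 An'; rewrite -AE => <-; congr c'.
    by rewrite AE !image_comp; apply: eq_imagel => x _ /=; rewrite phi1.
  - pose A' := [set x : of_color c2 P | A (sval x)].
    have AE : A = sval @` A'.
      apply/seteqP; split=> [a Aa|_ [x Ax <-] //].
      by exists (exist _ a (AP _ Aa)).
    have An' : A' #= `I_n by move: An; rewrite {1}AE; move/(card_img_inj _ _ (@sig_inj _ _)).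
    have := eh2.2 n A' n0 An'; rewrite -AE => <-; congr c'.
    by rewrite AE !image_comp; apply: eq_imagel => x _ /=; rewrite phi2.
  - move=> n S d Sn SP Sd; apply: (mN'.2 n (phi @` S)).
      by apply: card_img Sn; exact: phiA.
    move=> k _ /sub_image[B BS ->] Bk; apply: Sd => //.
    apply: card_eq_trans Bk; apply: card_esym; apply: inj_card_eq; apply: phiA.
    by move=> z /BS/SP.
have [s sar] := ex_symbol_of N.
have [cb [eb1 eb2 cbs]] := union_coloring s f1i f2i fg fI e1 e2.
pose c (A : set N) := match pselect (exists P, forall z, A z -> pc z = P) with
  | left h => cP (sval (cid h)) A | right _ => cb A end.
have cmono P A : A !=set0 -> (forall z, A z -> pc z = P) -> c A = cP P A.
  move=> [z Az] AP; rewrite /c; case: pselect => [h|[]]; last by exists P.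
  by congr cP; rewrite -(AP z Az); symmetry; exact: (svalP (cid h)).
have ec1 : color_emb c1 c f1.
  split=> // n A n0 An; have [[P AP]|nP] := pselect (exists P, forall a, A a -> c1 [set a] = P).
    have [_ cP1 _ _] := cPP P; rewrite (cmono P) ?(cP1 n) //.
      by have [a Aa] := card_nonempty n0 An; exists (f1 a), a.
    by move=> _ [a Aa <-]; rewrite pc1; exact: AP.
  rewrite /c; case: pselect => [[P AP]|_]; last exact: eb1.2 An.
  by case: nP; exists P => a Aa; rewrite -pc1; apply: AP; exists a.
have ec2 : color_emb c2 c f2.
  split=> // n A n0 An; have [[P AP]|nP] := pselect (exists P, forall a, A a -> c2 [set a] = P).
    have [_ _ cP2 _] := cPP P; rewrite (cmono P) ?(cP2 n) //.
      by have [a Aa] := card_nonempty n0 An; exists (f2 a), a.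
    by move=> _ [a Aa <-]; rewrite pc2; exact: AP.
  rewrite /c; case: pselect => [[P AP]|_]; last exact: eb2.2 An.
  by case: nP; exists P => a Aa; rewrite -pc2; apply: AP; exists a.
exists N, c, f1, f2; split=> //; split=> [n A n0 An|[|n] S d Sn Sd].
- have A0 := card_nonempty n0 An.
  have [[P AP]|nP] := pselect (exists P, forall z, A z -> pc z = P).
    by rewrite (cmono P) //; have [cPar _ _ _] := cPP P; exact: cPar.
  rewrite /c; case: pselect => // _.
  have [/sub_image[A1 _ AE]|n1] := pselect (A `<=` range f1).
    move: An; rewrite AE => /(card_img_inj _ _ f1i) An.
    by rewrite (eb1.2 n) //; apply: m1.1.
  have [/sub_image[A2 _ AE]|n2] := pselect (A `<=` range f2).
    move: An; rewrite AE => /(card_img_inj _ _ f2i) An.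
    by rewrite (eb2.2 n) //; apply: m2.1.
  by rewrite cbs //; exact: sar.
- exact: allowed0.
- have SP z : S z -> pc z = d ord0.
    move=> Sz; rewrite -(diagram_points Sd Sz).
    have [[a <-]|[b <-]] := fU z; first by rewrite pc1 (color_emb1 _ ec1).
    by rewrite pc2 (color_emb1 _ ec2).
  have [_ _ _ h] := cPP (d ord0); apply: (h _ _ _ Sn SP) => k B BS Bk.
  rewrite -(Sd k B) // (cmono (d ord0)) //; first exact: card_nonempty Bk.
  by move=> z /BS/SP.
Qed.

End Amalgams.

(** * Colors without infinite branches *)

Section RareColors.
Variables (L : language) (W : allowed_diagrams L).

Definition sum_mixed (T E : Type) (A : set (T + E)) : Prop :=
  (exists a, A (inl a)) /\ (exists e, A (inr e)).

Definition marked (T E : Type) (Z : set T) (X : L) (A : set (T + E)) : Prop :=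
  exists a (F : set E), [/\ Z a, F #= `I_(arity X).-1 & A = inl a |` inr @` F].

(** The sets of the disjoint sum T + E that meet both summands are colored by a
    symbol depending only on their size, except for the sets consisting of one
    point of Z and of points of E, which get the color [X] if their size allows
    it: this tells the points of Z from the others. *)
Definition sum_coloring (s : nat -> L) (T E : Type) (c : set T -> L) (w : nat -> L)
    (Z : set T) (X : L) (cE : set (T + E) -> L) : Prop :=
  [/\ color_emb c cE inl,
      forall k A, A #= `I_k.+1 -> cE (inr @` A) = w k,
      forall n A, A #= `I_n -> sum_mixed A -> marked Z X A -> cE A = X
    & forall n A, A #= `I_n -> sum_mixed A -> ~ marked Z X A -> cE A = s n].

Lemma sum_split (T E : Type) (A : set (T + E)) :
  [\/ exists A1, A = inl @` A1, exists A2, A = inr @` A2 | sum_mixed A].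
Proof.
have [n1|/contrapT l] := pselect (~ exists a, A (inl a)).
  constructor 2; exists [set e | A (inr e)]; apply/seteqP.
  by split=> [[a|e] Ax|_ [e Ae <-] //]; [case: n1; exists a|exists e].
have [n2|/contrapT r] := pselect (~ exists e, A (inr e)); last by constructor 3.
constructor 1; exists [set a | A (inl a)]; apply/seteqP.
by split=> [[a|e] Ax|_ [a Aa <-] //]; [exists a|case: n2; exists e].
Qed.

Lemma ex_sum_coloring (s : nat -> L) (T E : Type) (c : set T -> L) (w : nat -> L)
  (Z : set T) (X : L) : exists cE : set (T + E) -> L, sum_coloring s c w Z X cE.
Proof.
have [sz szE] := ex_size_of (T + E).
have [sz' szE'] := ex_size_of E.
exists (fun A => match pselect (exists A1, A = inl @` A1) with
  | left h => c (sval (cid h)) | right _ =>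
  match pselect (exists A2, A = inr @` A2) with
  | left h => w (sz' (sval (cid h))) | right _ =>
  if `[< marked Z X A >] then X else s (sz A).+1 end end).
have mix (A : set (T + E)) : sum_mixed A ->
    ~ (exists A1, A = inl @` A1) /\ ~ (exists A2, A = inr @` A2).
  by move=> [[a Aa] [e Ae]]; split=> -[A' AE]; [move: Ae|move: Aa]; rewrite AE => -[].
split.
- split=> [|n A n0 An]; first exact: inl_inj.
  case: pselect => [h|[]]; last by exists A.
  by congr c; apply: (image_set_inj (@inl_inj T E)); rewrite -(svalP (cid h)).
- move=> k A Ak; have [e Ae] := card_nonempty (ltn0Sn k) Ak.
  case: pselect => [[A1 AE]|_].
    have : (inl @` A1) (inr e : T + E) by rewrite -AE; exists e.
    by move=> [].
  case: pselect => [h|[]]; last by exists A.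
  rewrite (szE' k) //; suff -> : sval (cid h) = A by [].
  by apply: (image_set_inj (@inr_inj T E)); rewrite -(svalP (cid h)).
- move=> n A An /mix[n1 n2] mA; case: pselect => // _; case: pselect => // _.
  by rewrite (asboolT mA).
- move=> n A An mA nA; have [n1 n2] := mix _ mA.
  case: pselect => // _; case: pselect => // _; rewrite (asboolF nA).
  case: n An => [|n] An; last by rewrite (szE n).
  by case: mA => [[a]]; move/card_I0P: An => ->.
Qed.

Lemma sum_coloring_model (s : nat -> L) (T E : Type) (c : set T -> L) (w : nat -> L)
    (Z : set T) (X P : L) (cE : set (T + E) -> L) :
  (forall n, 0 < n -> arity (s n) = n) -> model W c -> (forall a, c [set a] = P) ->
  branch W w -> w 0 <> P -> sum_coloring s c w Z X cE -> model W cE.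
Proof.
move=> sar mc cP bw wP [el er em en].
split=> [n A n0 An|[|n] S d Sn Sd]; last 2 first.
- exact: allowed0.
- have dl a : S (inl a) -> d ord0 = P.
    by move=> Sa; rewrite -(diagram_points Sd Sa) (color_emb1 _ el).
  have dr e : S (inr e) -> d ord0 = w 0.
    move=> Se; rewrite -(diagram_points Sd Se) -image_set1 (er 0) //.
    exact: card_set1.
  have [[S1 SE]|[S2 SE]|[[a /dl da] [e /dr de]]] := sum_split S.
  + by apply: diagram_pull mc el Sn _ Sd; rewrite SE => _ [a _ <-]; exists a.
  + suff -> : d = fun k : 'I_n.+1 => w k by [].
    apply: funext => k; have S2n : S2 #= `I_n.+1.
      by move: Sn; rewrite SE => /(card_img_inj _ _ (@inr_inj _ _)).
    have [C [_ CS Ck]] := card_between (m := k.+1) (@sub0set _ S2)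
      ((card_I0P _).2 erefl) S2n (ltn_ord k).
    rewrite -(er k C Ck); symmetry; apply: Sd; last exact/card_img_inj/Ck/inr_inj.
    by rewrite SE; exact: image_subset.
  + by case: wP; rewrite -de.
have [[A1 AE]|[A2 AE]|mA] := sum_split A.
- move: An; rewrite AE => /(card_img_inj _ _ (@inl_inj _ _)) An.
  by rewrite (el.2 n) //; exact: mc.1.
- move: An; rewrite AE => /(card_img_inj _ _ (@inr_inj _ _)).
  by case: n n0 => // n _ An; rewrite (er n) // (branch_arity _ bw).
have [kA|nA] := pselect (marked Z X A); last by rewrite (en n) // sar.
rewrite (em n) //; move: kA An => [a [F [_ Fn ->]]] An.
have := card_IU1 (x := inl a) _ ((card_img_inj F _ (@inr_inj T E)).2 Fn).
rewrite prednK ?arity_gt0 // => h; apply: card_I_inj An; apply: h.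
by move=> [].
Qed.

Definition sum_map (T0 T1 E : Type) (g : T0 -> T1) (x : T0 + E) : T1 + E :=
  match x with inl a => inl (g a) | inr e => inr e end.

Lemma sum_map_emb (s : nat -> L) (T0 T1 E : Type) (c0 : set T0 -> L) (c1 : set T1 -> L)
    (w : nat -> L) (g : T0 -> T1) (X : L) (cE0 : set (T0 + E) -> L)
    (cE1 : set (T1 + E) -> L) :
  color_emb c0 c1 g -> sum_coloring s c0 w set0 X cE0 ->
  sum_coloring s c1 w (~` range g) X cE1 -> color_emb cE0 cE1 (sum_map g).
Proof.
move=> eg [el0 er0 _ en0] [el1 er1 _ en1].
have mi : injective (sum_map (E := E) g).
  by move=> [a|e] [b|f] //= []; [move=> /(eg.1) ->|move=> ->].
split=> // n A n0 An; have [[A1 AE]|[A2 AE]|mA] := sum_split A.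
- move: An; rewrite AE => /(card_img_inj _ _ (@inl_inj _ _)) An.
  rewrite (el0.2 n) // -(eg.2 n) // -(el1.2 n) //; last exact/card_img_inj/An/(eg.1).
  by rewrite !image_comp.
- move: An; rewrite AE => /(card_img_inj _ _ (@inr_inj _ _)).
  by case: n n0 => // n _ An; rewrite (er0 n) // -(er1 n A2) // image_comp.
- rewrite (en0 n) //; last by move=> [a [F []]].
  apply: en1.
  + exact/card_img_inj.
  + move: mA => [[a Aa] [e Ae]]; split.
      by exists (g a), (inl a).
    by exists e, (inr e).
  + move=> [a [F [na _ AE]]]; have : (sum_map g @` A) (inl a) by rewrite AE; left.
    by move=> [[b|e] _ //= [ba]]; apply: na; exists b.
Qed.

Definition codable : Prop :=
  exists X1 X2 : L, [/\ X1 <> X2, arity X1 = arity X2 & 1 < arity X1].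

(** Two models whose points all have the color [P] are enlarged by a set E of
    size [mu] colored along a branch [w] that does not start with [P].  When
    [D] does not provide disjointness, the two models are coded differently on E,
    so that no new point of the first model can be identified with a new
    point of the second one. *)
Lemma amalgam_rare_color (D : Prop) (mu : cardinal) (P : L) (w : nat -> L)
    (T0 T1 T2 : cardinal) (c0 : set T0 -> L)
    (c1 : set T1 -> L) (c2 : set T2 -> L) (g1 : T0 -> T1) (g2 : T0 -> T2) :
  D \/ codable -> amalgamates D W mu -> emb nat mu -> branch W w -> w 0 <> P ->
  model W c0 -> model W c1 -> model W c2 ->
  color_emb c0 c1 g1 -> color_emb c0 c2 g2 ->
  (forall a, c0 [set a] = P) -> (forall a, c1 [set a] = P) ->
  (forall a, c2 [set a] = P) ->
  emb T0 mu -> emb T1 mu -> emb T2 mu ->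
  amalgam True W c1 c2 g1 g2.
Proof.
move=> DC AP imu bw wP m0 m1 m2 e1 e2 P0 P1 P2 T0mu T1mu T2mu.
have [s sar] : exists s : nat -> L, forall n, 0 < n -> arity (s n) = n.
  suff /choice[s sP] : forall n, exists X : L, 0 < n -> arity X = n by exists s.
  move=> [|n]; first by exists P.
  by have [X XP] := arity_surj L (ltn0Sn n); exists X.
have [X1 [X2 X12]] : exists X1 X2 : L,
    D \/ [/\ X1 <> X2, arity X1 = arity X2 & 1 < arity X1].
  by case: DC => [d|[X1 [X2 ?]]]; [exists P, P; left|exists X1, X2; right].
have [cE01 k01] := ex_sum_coloring s mu c0 w set0 X1.
have [cE1 k1] := ex_sum_coloring s mu c1 w (~` range g1) X1.
have [cE2 k2] := ex_sum_coloring s mu c2 w (~` range g2) X2.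
have k02 : sum_coloring s c0 w set0 X2 cE01.
  case: k01 => el er em en; split=> // n A An mA; first by move=> [a [F []]].
  by move=> _; apply: en => // -[a [F []]].
have sz (T : cardinal) : emb T mu -> [set: (T + mu)%type] #= [set: mu].
  move=> Tmu; apply/setT_card_eq; split; first by apply: emb_sum => //; exact: emb_refl.
  by exists inr; exact: inr_inj.
have [N [c [f1 [f2 [mN ef1 ef2 fg fI]]]]] :=
  AP _ _ _ cE01 cE1 cE2 (sum_map g1) (sum_map g2)
  (sum_coloring_model sar m0 P0 bw wP k01) (sum_coloring_model sar m1 P1 bw wP k1)
  (sum_coloring_model sar m2 P2 bw wP k2) (sz _ T0mu) (sz _ T1mu) (sz _ T2mu)
  (sum_map_emb e1 k01 k1) (sum_map_emb e2 k02 k2).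
have el1 : color_emb c1 c (f1 \o inl).
  split=> [x y /= /(ef1.1)[] //|n A n0 An]; have [el _ _ _] := k1.
  rewrite -image_comp (ef1.2 n) //; first exact: (el.2 n).
  exact/card_img_inj/An/inl_inj.
have el2 : color_emb c2 c (f2 \o inl).
  split=> [x y /= /(ef2.1)[] //|n A n0 An]; have [el _ _ _] := k2.
  rewrite -image_comp (ef2.2 n) //; first exact: (el.2 n).
  exact/card_img_inj/An/inl_inj.
exists N, c, (f1 \o inl), (f2 \o inl); split=> //.
  by move=> m; exact: (fg (inl m)).
move=> _ a b /= fab.
have fgl m : f1 (inl (g1 m)) = f2 (inl (g2 m)) by exact: (fg (inl m)).
have [[m _ am]|na] := pselect (range g1 a).
  by exists m => //; apply/esym/(el2.1); rewrite /= -fgl am.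
have nb : ~ range g2 b.
  move=> [m _ bm]; apply: na; exists m => //.
  by apply: (el1.1); rewrite /= fgl bm.
exfalso; have [d|[X12n X12a X1gt]] := X12.
  by have [[m|e] //= [am] _] := fI d _ _ fab; apply: na; exists m.
have [F Fn] : exists F : set mu, F #= `I_(arity X1).-1.
  by case: imu => f fi; exists (f @` `I_(arity X1).-1); apply/card_img_inj.
have [e Fe] : F !=set0 by apply: card_nonempty Fn; case: (arity X1) X1gt => [|[]].
apply: X12n; pose tooth (T : Type) (a : T) : set (T + mu) := inl a |` inr @` F.
have toothn (T : Type) (x : T) : tooth T x #= `I_(arity X1).
  rewrite -(prednK (arity_gt0 X1)); apply: card_IU1; last exact/card_img_inj/Fn/inr_inj.
  by move=> [].
have mixed (T : Type) (x : T) : sum_mixed (tooth T x).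
  by split; [exists x; left|exists e; right; exists e].
have <- : cE1 (tooth _ a) = X1.
  by have [_ _ em _] := k1; apply: (em _ _ (toothn _ a)) => //; exists a, F.
have <- : cE2 (tooth _ b) = X2.
  have [_ _ em _] := k2; apply: (em _ _ (toothn _ b)) => //.
  by exists b, F; rewrite -X12a.
rewrite -(ef1.2 _ _ (arity_gt0 X1) (toothn _ a)) -(ef2.2 _ _ (arity_gt0 X1) (toothn _ b)).
congr c; rewrite /tooth !image_setU !image_set1 fab !image_comp; congr (_ `|` _).
by apply: eq_imagel => u _ /=; exact: (fg (inr u)).
Qed.

(** * Amalgamation by identification *)

(** If the sets of the same size n >= 2 have all the same color, a model is
    determined by the number of its points of each color, and two extensions of
    a common submodel are amalgamated by identifying, color by color, the new
    points of the smaller one with some new points of the other. *)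
Lemma amalgam_identify (T0 T1 T2 : cardinal) (c0 : set T0 -> L)
    (c1 : set T1 -> L) (c2 : set T2 -> L) (g1 : T0 -> T1) (g2 : T0 -> T2) :
  ~ codable -> T1 -> T2 -> model W c1 -> model W c2 ->
  color_emb c0 c1 g1 -> color_emb c0 c2 g2 -> amalgam False W c1 c2 g1 g2.
Proof.
move=> nc t1 t2 m1 m2 e1 e2.
have uniq (X1 X2 : L) : arity X1 = arity X2 -> 1 < arity X1 -> X1 = X2.
  by move=> e gt; apply: contrapT => ne; apply: nc; exists X1, X2.
pose A P := [set a | ~ range g1 a /\ c1 [set a] = P].
pose B P := [set b | ~ range g2 b /\ c2 [set b] = P].
(* In the colors P with [win P], the first model has at least as many new points
   as the second one. *)
pose win P := emb {b | B P b} {a | A P a}.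
have [i iP] : exists i : L -> T1 -> T2, forall P, ~ win P ->
    (forall x, A P x -> B P (i P x)) /\
    forall x y, A P x -> A P y -> i P x = i P y -> x = y.
  suff /choice[i iP] : forall P, exists i : T1 -> T2, ~ win P ->
    (forall x, A P x -> B P (i x)) /\
    forall x y, A P x -> A P y -> i x = i y -> x = y by exists i.
  move=> P; have [h|h] := emb_total {b | B P b} {a | A P a}; first by exists (fun=> t2).
  by have [j jP] := emb_extend t2 h; exists j.
have [j jP] : exists j : L -> T2 -> T1, forall P, win P ->
    (forall x, B P x -> A P (j P x)) /\
    forall x y, B P x -> B P y -> j P x = j P y -> x = y.
  suff /choice[j jP] : forall P, exists j : T2 -> T1, win P ->
    (forall x, B P x -> A P (j x)) /\
    forall x y, B P x -> B P y -> j x = j y -> x = y by exists j.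
  move=> P; have [h|h] := pselect (win P); last by exists (fun=> t1).
  by have [i' i'P] := emb_extend t1 h; exists i'.
pose keep (z : T1 + T2) := match z with
  | inl a => range g1 a \/ win (c1 [set a])
  | inr b => ~ range g2 b /\ ~ win (c2 [set b]) end.
pose N : cardinal := {z | keep z}.
pose F1 a : T1 + T2 := if `[< keep (inl a) >] then inl a else inr (i (c1 [set a]) a).
pose F2 b : T1 + T2 := match pselect (exists m, g2 m = b) with
  | left h => inl (g1 (sval (cid h)))
  | right _ => if `[< win (c2 [set b]) >] then inl (j (c2 [set b]) b) else inr b end.
have F1Y a : keep (inl a) -> F1 a = inl a by move=> h; rewrite /F1 asboolT.
have F1N a : ~ keep (inl a) -> F1 a = inr (i (c1 [set a]) a) /\
    A (c1 [set a]) a /\ ~ win (c1 [set a]).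
  move=> h; rewrite /F1 asboolF //; split=> //.
  by split; [split=> // r; apply: h; left|move=> r; apply: h; right].
have F2g m : F2 (g2 m) = inl (g1 m).
  rewrite /F2; case: pselect => [h|[]]; last by exists m.
  by congr (inl (g1 _)); apply: (e2.1); exact: svalP (cid h).
have F2N b : ~ range g2 b ->
    F2 b = if `[< win (c2 [set b]) >] then inl (j (c2 [set b]) b) else inr b.
  by move=> nb; rewrite /F2; case: pselect => // -[m gm]; case: nb; exists m.
have keep1 a : keep (F1 a).
  have [h|h] := pselect (keep (inl a)); first by rewrite F1Y.
  have [-> [Aa nw]] := F1N _ h.
  by have [/(_ _ Aa)[nr /= ->] _] := iP _ nw.
have keep2 b : keep (F2 b).
  have [[m _ <-]|nb] := pselect (range g2 b); first by rewrite F2g; left; exists m.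
  rewrite (F2N _ nb); case: asboolP => [h|h]; last by split.
  by have [/(_ b (conj nb erefl))[_ /= ->] _] := jP _ h; right.
pose f1 a : N := exist _ (F1 a) (keep1 a).
pose f2 b : N := exist _ (F2 b) (keep2 b).
pose pc (z : N) := match sval z with inl a => c1 [set a] | inr b => c2 [set b] end.
have pc1 a : pc (f1 a) = c1 [set a].
  rewrite /pc /=; have [h|h] := pselect (keep (inl a)); first by rewrite F1Y.
  have [-> [Aa nw]] := F1N _ h.
  by have [/(_ _ Aa)[]] := iP _ nw.
have pc2 b : pc (f2 b) = c2 [set b].
  rewrite /pc /=; have [[m _ <-]|nb] := pselect (range g2 b).
    by rewrite F2g (color_emb1 _ e1) (color_emb1 _ e2).
  rewrite (F2N _ nb); case: asboolP => [h|h] //.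
  by have [/(_ b (conj nb erefl))[]] := jP _ h.
have f1i : injective f1.
  move=> a b /[dup] /(congr1 pc); rewrite !pc1 => cab /(congr1 sval) /=.
  have [h|h] := pselect (keep (inl a)).
    rewrite (F1Y a h); have [h'|h'] := pselect (keep (inl b)).
      by rewrite F1Y // => -[].
    by have [-> _] := F1N _ h'.
  have [-> [Aa nw]] := F1N _ h; have [h'|h'] := pselect (keep (inl b)).
    by rewrite F1Y.
  have [-> [Ab _]] := F1N _ h'; rewrite -cab in Ab *.
  by have [_ ii] := iP _ nw => -[]; apply: ii.
have f2i : injective f2.
  move=> a b /[dup] /(congr1 pc); rewrite !pc2 => cab /(congr1 sval) /=.
  have [[m _ <-]|na] := pselect (range g2 a).
    rewrite F2g; have [[m' _ <-]|nb] := pselect (range g2 b).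
      by rewrite F2g => -[/(e1.1) ->].
    rewrite F2N //; case: asboolP => // h [mj].
    have [/(_ b (conj nb erefl))[nr _] _] := jP _ h.
    by case: nr; exists m.
  rewrite (F2N _ na); have [[m _ <-]|nb] := pselect (range g2 b).
    rewrite F2g; case: asboolP => // h [mj].
    have [/(_ a (conj na erefl))[nr _] _] := jP _ h.
    by case: nr; exists m.
  rewrite (F2N _ nb) -cab; case: asboolP => [h|h] [] //.
  by have [_ ji] := jP _ h; apply: ji.
(* The points of each color all come from the same model. *)
have colored z : win (pc z) -> range f1 z.
  case: z => -[a|b] k /=; last by move=> h; case: (proj2 k h).
  by move=> _; exists a => //; apply: sig_inj; rewrite /= F1Y.
have colored' z : ~ win (pc z) -> range f2 z.
  case: z => -[a|b] k nw.
    have [[m _ ma]|/nw //] := k; exists (g2 m) => //; apply: sig_inj.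
    by rewrite /= F2g ma.
  exists b => //; apply: sig_inj; rewrite /= F2N; last exact: (proj1 k).
  by rewrite asboolF.
have [s sar] := ex_symbol_of L N.
pose c (S : set N) := if `[< exists z, S = [set z] >] then at_some (s S) pc S else s S.
have cpt z : c [set z] = pc z.
  by rewrite /c asboolT ?at_some1 //; exists z.
have cbig n S : S #= `I_n.+2 -> c S = s S.
  move=> Sn; rewrite /c asboolF // => -[z zS]; move: Sn; rewrite zS => Sn.
  by have := card_I_inj (card_set1 (x := z)) Sn.
have ec1 : color_emb c1 c f1.
  split=> // -[//|[|n]] S _ Sn.
    by move/card_I1P: Sn => [a ->]; rewrite image_set1 cpt pc1.
  have fSn := (card_img_inj S n.+2 f1i).2 Sn.
  by rewrite (cbig _ _ fSn); apply: uniq; rewrite (sar n.+2) // (m1.1 n.+2).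
have ec2 : color_emb c2 c f2.
  split=> // -[//|[|n]] S _ Sn.
    by move/card_I1P: Sn => [a ->]; rewrite image_set1 cpt pc2.
  have fSn := (card_img_inj S n.+2 f2i).2 Sn.
  by rewrite (cbig _ _ fSn); apply: uniq; rewrite (sar n.+2) // (m2.1 n.+2).
exists N, c, f1, f2; split=> //; last first.
  move=> m; apply: sig_inj; rewrite /= F2g F1Y //.
  by left; exists m.
split=> [[//|[|n]] S _ Sn|[|n] S d Sn Sd].
- move/card_I1P: Sn => [z ->]; rewrite cpt /pc; case: (sval z) => u.
    by apply: m1.1 => //; exact: card_set1.
  by apply: m2.1 => //; exact: card_set1.
- by rewrite (cbig n) //; exact: sar.
- exact: allowed0.
have Sc z : S z -> pc z = d ord0 by move=> /(diagram_points Sd); rewrite cpt.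
have [h|h] := pselect (win (d ord0)).
  by apply: diagram_pull m1 ec1 Sn _ Sd => z /Sc e; apply: colored; rewrite e.
by apply: diagram_pull m2 ec2 Sn _ Sd => z /Sc e; apply: colored'; rewrite e.
Qed.

End RareColors.

(** * Amalgamation above beth_{kappa^+} *)

Lemma card_ltP (lam mu : cardinal) : card_lt lam mu <-> ~ emb mu lam.
Proof.
split=> [[lm /negP ne] ml|nml].
  by apply: ne; apply/setT_card_eq; split=> //; exact/setT_card_le.
split; first by apply/setT_card_le; have [] := emb_total lam mu.
by apply/negP => /setT_card_eq[].
Qed.

Section Upper.
Variables (kappa I : cardinal) (R : rel I) (Rwo : well_order R) (x0 : I).
Hypotheses (ik : emb nat kappa) (x0S : is_succ_cardinal kappa R x0).
Let lam := beth Rwo x0.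
Variables (L : language) (W : allowed_diagrams L).
Hypothesis Lk : emb L kappa.

Lemma big_branch (T : Type) (c : set T -> L) : model W c -> ~ emb T lam ->
  exists2 w, branch W w & forall n, realized c w n.
Proof.
move=> [_ dg] big; have [w wr] := infinite_branch c ik x0S Lk big.
by exists w => // n; have [S Sn hS] := wr n; apply: (dg n S) => // k B; exact: hS.
Qed.

Lemma rare_small (T : Type) (c : set T -> L) P : model W c ->
  (forall a, c [set a] = P) -> ~ (exists2 w, branch W w & w 0 = P) -> emb T lam.
Proof.
move=> mc cP rare; apply: contrapT => /(big_branch mc)[w bw wr]; apply: rare.
exists w => //; have [S /card_I1P[a ->] hS] := wr 1.
by rewrite -(cP a); symmetry; apply: (hS 0) => //; exact: card_set1.
Qed.

(** A color that starts no branch has at most [lam] points, hence its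
    points can be amalgamated inside models of size [mu], and the other colors
    cause no obstruction.  The exception is that of non-disjoint amalgamation
    when there is no way of coding; then amalgams always exist. *)
Lemma amalgamates_transfer (D : Prop) (mu mu' : cardinal) :
  ~ emb mu lam -> ~ emb mu' lam -> amalgamates D W mu -> amalgamates D W mu'.
Proof.
move=> mubig mu'big AP T0 T1 T2 c0 c1 c2 g1 g2 m0 m1 m2.
move=> /setT_card_eq[T0mu' mu'T0] /setT_card_eq[T1mu' mu'T1].
move=> /setT_card_eq[T2mu' mu'T2] e1 e2.
have lammu : emb lam mu by have [] := emb_total lam mu.
have imu : emb nat mu by apply: emb_trans lammu; exact: nat_beth.
have inhab (T : Type) : emb mu' T -> exists t : T, True.
  move=> [f _]; apply: contrapT => no; apply: mu'big.
  by exists (fun y => match no (ex_intro _ (f y) Logic.I) with end) => y; case: no; exists (f y).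
have [w bw _] : exists2 w, branch W w & forall n, realized c0 w n.
  by apply: big_branch m0 _ => h; apply: mu'big; apply: emb_trans h.
have [DC|nDC] := pselect (D \/ codable L); last first.
  have [t1 _] := inhab _ mu'T1; have [t2 _] := inhab _ mu'T2.
  have nc : ~ codable L by move=> h; apply: nDC; right.
  have [N [c [f1 [f2 [? ? ? ? _]]]]] := amalgam_identify nc t1 t2 m1 m2 e1 e2.
  by exists N, c, f1, f2; split=> // d; case: nDC; left.
suff [N [c [f1 [f2 [? ? ? ? fI]]]]] : amalgam True W c1 c2 g1 g2.
  by exists N, c, f1, f2; split=> // _; exact: fI.
apply: (amalgam_glue (e1 := e1) (e2 := e2) m1 m2) => P.
have si T (c : set T -> L) := @sig_inj T (fun a => c [set a] = P).
have mP (T : cardinal) (c : set T -> L) : model W c ->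
    model W (fun A : set (of_color c P) => c (sval @` A)).
  exact/model_pull/si.
have cP (T : cardinal) (c : set T -> L) (a : of_color c P) : c (sval @` [set a]) = P.
  by rewrite image_set1; exact: (svalP a).
have eP (T T' : cardinal) (c : set T -> L) (c' : set T' -> L) (g : T -> T')
    (e : color_emb c c' g) : color_emb (fun A : set (of_color c P) => c (sval @` A))
      (fun A : set (of_color c' P) => c' (sval @` A))
      (fun m : of_color c P => exist (fun a => c' [set a] = P) (g (sval m))
          (etrans (color_emb1 _ e) (svalP m))).
  split=> [m m' [] /(e.1)/si //|n A n0 An].
  rewrite -(e.2 n) //; last exact/card_img_inj/An/si.
  by rewrite !image_comp.
have [[w' bw' w'P]|rare] := pselect (exists2 w, branch W w & w 0 = P).
  by apply: (amalgam_branch bw') (eP _ _ _ _ _ e1) (eP _ _ _ _ _ e2) _ _; rewrite ?w'P //;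
    [exact: mP|exact: mP].
have small T (c : set T -> L) : model W c -> emb (of_color c P) mu.
  move=> mc; apply: emb_trans lammu.
  by apply: (rare_small (mP _ _ mc)) rare => a; exact: cP.
apply: (amalgam_rare_color DC AP imu bw _ (mP _ _ m0) (mP _ _ m1) (mP _ _ m2)
  (eP _ _ _ _ _ e1) (eP _ _ _ _ _ e2)) => //; try exact: cP; try exact: small.
by move=> wP; apply: rare; exists w.
Qed.

End Upper.

(** * Failure of amalgamation below beth_{kappa^+} *)

Lemma card_I_eq (T : Type) (A B : set T) n :
  A `<=` B -> A #= `I_n -> B #= `I_n -> A = B.
Proof.
move=> AB An Bn; apply/seteqP; split=> // x Bx; apply: contrapT => nAx.
have [|m mn Am] := card_I_sub _ Bn (A := x |` A); first by move=> y [->|/AB].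
by move: mn; rewrite -(card_I_inj (card_IU1 nAx An) Am) ltnn.
Qed.

Lemma card_I_two (T : Type) (A : set T) n : A #= `I_n.+2 ->
  exists x y, [/\ A x, A y & x <> y].
Proof.
move=> /eq_cardSP[x Ax /eq_cardSP[y [Ay ne] _]].
by exists x, y; split=> // e; apply: ne.
Qed.

Section Lower.
Variables (kappa X : cardinal).
Hypothesis ik : emb nat kappa.
Variables (c : set X -> kappa) (k0 : kappa).
Hypothesis c_wf : forall w, exists n, ~ realized c w n.

Let Q : cardinal := option kappa.

Definition nat_language : language.
Proof.
refine (@Language (nat * Q)%type (fun P => P.1.+1) _ _) => //.
by case=> // n _; exists (n, None).
Defined.

Lemma nat_language_size : has_size nat_language kappa.
Proof.
apply/setT_card_eq; split.
  by apply: emb_pair => //; apply: emb_option_inf => //; exact: emb_refl.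
by exists (fun a => (0, Some a)) => a b [].
Qed.

(** Homogeneous sets of points colored [None] have at most two elements, and the
    other ones are those of the given coloring of X. *)
Definition sparse (n : nat) (w : 'I_n -> nat_language) : Prop :=
  (forall k : 'I_n, arity (w k) = k.+1) /\
  ((n <= 2 /\ forall k : 'I_n, k = 0 :> nat -> (w k).2 = None) \/
   exists2 S : set X, S #= `I_n & forall (k : 'I_n) A, A `<=` S -> A #= `I_k.+1 ->
     (w k).2 = Some (c A)).

Definition sparse_diagrams : allowed_diagrams nat_language.
Proof.
refine (@AllowedDiagrams nat_language sparse _ _ _).
- exists 0, (fun _ => (0, None)); split; first by case.
  by left; split=> //; case.
- by move=> n w [].
- move=> m n mn w [aw Ww]; split; first by move=> k; rewrite aw.
  case: Ww => [[n2 w0]|[S Sn Sw]].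
    left; split; first exact: leq_trans n2.
    by move=> k k0'; apply: w0.
  have [S' [_ S'S S'm]] :=
    card_between (m := m) (@sub0set _ S) ((card_I0P _).2 erefl) Sn mn.
  right; exists S' => // k A AS Ak; apply: Sw => //.
  by move=> x /AS/S'S.
Defined.

(** The points are those of X, a point for each element of Q, and a further
    point [None].  The pair of [None] and the point of q has the color q, so a
    second point of this kind and [None] span with the point of q a triangle that
    is not allowed, q being the color of the pair that they form.  The pairs of
    points of Q have pairwise distinct colors, and the color [u] of some
    triangles prevents the two points from being identified. *)
Definition ext := option (X + Q).
Definition qpt (q : Q) : ext := Some (inr q).
Definition xpt (x : X) : ext := Some (inl x).

Definition ext_color (u : Q) (col : set ext -> Q) : Prop :=
  [/\ forall A, A !=set0 -> col (xpt @` A) = Some (c A),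
      forall z, ~ range xpt z -> col [set z] = None,
      forall q, col [set qpt q; None] = q
    & forall q q', q <> q' -> col [set qpt q; qpt q'; None] = u].

Definition pair_color (col : set ext -> Q) : Prop :=
  forall q q' r r', q <> q' -> r <> r' ->
    col [set qpt q; qpt q'] = col [set qpt r; qpt r'] ->
    [set qpt q; qpt q'] = [set qpt r; qpt r'].

Lemma ex_ext_color : exists col : Q -> set ext -> Q,
  (forall u, ext_color u (col u) /\ pair_color (col u)) /\
  forall u u' A, ~ A None -> col u A = col u' A.
Proof.
have iQ : emb nat Q by apply: emb_trans ik _; exists Some => a b [].
have [p pi] : emb (Q * Q) Q by exact: emb_square.
pose col u (A : set ext) : Q :=
  match pselect (exists A1 : set X, A1 !=set0 /\ A = xpt @` A1) with
  | left h => Some (c (sval (cid h))) | right _ =>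
  match pselect (exists z, A = [set z]) with left _ => None | right _ =>
  match pselect (exists q, A = [set qpt q; None]) with
  | left h => sval (cid h) | right _ =>
  match pselect (exists r : Q * Q, A = [set qpt r.1; qpt r.2]) with
  | left h => p (sval (cid h)) | right _ =>
  if `[< A None >] then u else None end end end end.
exists col.
have xi : injective xpt by move=> x y [].
have noX (A : set ext) z : A z -> ~ range xpt z ->
    ~ exists A1 : set X, A1 !=set0 /\ A = xpt @` A1.
  by move=> Az nz [A1 [_ AE]]; apply: nz; move: Az; rewrite AE => -[x _ <-]; exists x.
have nq q : ~ range xpt (qpt q) by move=> [].
have nN : ~ range xpt None by move=> [].
have no1 (A : set ext) y z : A y -> A z -> y <> z -> ~ exists x, A = [set x].
  by move=> Ay Az ne [x AE]; apply: ne; move: Ay Az; rewrite AE => -> ->.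
split=> [u|u u' A nA]; last first.
  by rewrite /col; do 4![case: pselect => // _]; rewrite !asboolF.
split; [split|].
- move=> A A0; rewrite /col; case: pselect => [h|[]]; last by exists A.
  congr (Some (c _)); apply: (image_set_inj xi).
  by rewrite -(proj2 (svalP (cid h))).
- move=> z nz; rewrite /col; case: pselect => [/(noX [set z] z erefl nz)//|_].
  by case: pselect => // -[]; exists z.
- move=> q.
  have ne : qpt q <> None by [].
  rewrite /col.
  case: pselect => [/(noX _ None (or_intror erefl) nN)//|_].
  case: pselect => [/(no1 _ _ _ (or_introl erefl) (or_intror erefl) ne)//|_].
  case: pselect => [h|[]]; last by exists q.
  case: (cid h) => q' /= e; have : [set qpt q'; None] (qpt q) by rewrite -e; left.
  by case=> // -[].
- move=> q q' ne; rewrite /col; case: pselect => [/(noX _ None (or_intror erefl) nN)//|_].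
  have ne' : qpt q <> None by [].
  case: pselect => [/(no1 _ _ _ (or_introl (or_introl erefl)) (or_intror erefl) ne')//|_].
  case: pselect => [[r e]|_].
    have e1 : [set qpt r; None] (qpt q) by rewrite -e; left; left.
    have e2 : [set qpt r; None] (qpt q') by rewrite -e; left; right.
    by case: ne; case: e1 e2 => // -[->] [[->]|].
  case: pselect => [[r e]|_].
    have : [set qpt r.1; qpt r.2] None by rewrite -e; right.
    by case.
  by rewrite asboolT //; right.
- have pairE q q' : q <> q' -> exists2 r : Q * Q,
      [set qpt q; qpt q'] = [set qpt r.1; qpt r.2] &
      col u [set qpt q; qpt q'] = p r.
    move=> ne; have ne' : qpt q <> qpt q' by move=> [].
    rewrite /col; case: pselect => [/(noX _ _ (or_introl erefl) (nq q))//|_].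
    case: pselect => [/(no1 _ _ _ (or_introl erefl) (or_intror erefl) ne')//|_].
    case: pselect => [[r e]|_].
      have : [set qpt q; qpt q'] None by rewrite e; right.
      by case.
    case: pselect => [h|[]]; last by exists (q, q').
    by exists (sval (cid h)) => //; exact: svalP (cid h).
  move=> q q' r r' /pairE[s sE ->] /pairE[t tE ->] /pi st.
  by rewrite sE tE st.
Qed.

(** Among three points outside X, two edges have different colors. *)
Lemma ext_color_model (u : Q) (col : set ext -> Q) (sz : set ext -> nat) :
  (forall k A, A #= `I_k.+1 -> sz A = k) ->
  ext_color u col -> pair_color col ->
  model sparse_diagrams (fun A => (sz A, col A) : nat_language).
Proof.
move=> szE [cx cp cq _] pc; split=> [[//|n] A _ An|n S d Sn Sd].
  by rewrite /= (szE n).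
have dE (k : 'I_n) : exists A, [/\ A `<=` S, A #= `I_k.+1 & d k = (k : nat, col A)].
  have [A [_ AS Ak]] := card_between (m := k.+1) (@sub0set _ S)
    ((card_I0P _).2 erefl) Sn (ltn_ord k).
  by exists A; split=> //; rewrite -(Sd k A) // (szE k).
split=> [k|]; first by have [A [_ _ ->]] := dE k.
case: n d Sn Sd dE => [|n] d Sn Sd dE; first by left; split=> // -[].
have pt z : S z -> col [set z] = (d ord0).2.
  by move=> Sz; rewrite -(diagram_points Sd Sz).
have [[x Sx]|nx] := pselect (exists x, S (xpt x)).
  have d0 : (d ord0).2 <> None.
    by rewrite -(pt _ Sx) -image_set1 cx //; exists x.
  right; have [|S' _ SE] := @sub_image _ _ xpt setT S.
    move=> z Sz; apply: contrapT => nz; apply: d0; rewrite -(pt _ Sz).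
    exact: cp.
  have xi : injective xpt by move=> a b [].
  exists S'; first by apply/(card_img_inj _ _ xi); rewrite -SE.
  move=> k A AS Ak; rewrite -(Sd k (xpt @` A)) /=.
  + by rewrite cx //; exact: card_nonempty Ak.
  + by rewrite SE; exact: image_subset.
  + exact/card_img_inj.
left; have isq z : S z -> z <> None -> exists q, z = qpt q.
  by case: z => [[x|q]|] // Sz _; [case: nx; exists x|exists q].
split; last first.
  move=> k kz; have -> : k = ord0 by apply: val_inj.
  have [z Sz] := card_nonempty (ltn0Sn n) Sn.
  by rewrite -(pt z Sz) cp // => -[x _ xz]; apply: nx; exists x; rewrite xz.
rewrite ltnNge; apply/negP => n3.
case: n n3 d Sn Sd dE pt => [//|[//|n]] _ d Sn Sd _ _.
have edge (a b : ext) : S a -> S b -> a <> b -> col [set a; b] = (d (inord 1)).2.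
  move=> Sa Sb ab; rewrite -(Sd (inord 1) [set a; b]) //; first by move=> z [->|->].
  by rewrite inordK //; exact: card_I2.
have [SN|nSN] := pselect (S None).
  have [a [b [[Sa aN] [Sb bN] ab]]] := card_I_two (card_ID1 SN Sn).
  have [q aq] := isq _ Sa aN; have [r br] := isq _ Sb bN; apply: ab.
  by rewrite aq br -(cq q) -(cq r) -aq -br !edge.
have nN z : S z -> z <> None by move=> Sz e; rewrite e in Sz.
have [a Sa Sn'] := eq_cardSP _ _ Sn.
have [b [e [[Sb ba] [Se ea] be]]] := card_I_two Sn'.
have [q aq] := isq _ Sa (nN _ Sa); have [r br] := isq _ Sb (nN _ Sb).
have [t et] := isq _ Se (nN _ Se).
have : [set a; b] = [set a; e].
  rewrite aq br et; apply: pc; [by move=> h; apply: ba; rewrite aq br h|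
    by move=> h; apply: ea; rewrite aq et h|].
  by rewrite -aq -br -et !edge // => h; [apply: ea|apply: ba].
move=> E; have : [set a; e] b by rewrite -E; right.
by case.
Qed.

(** Homogeneous sets with more than two points live in X, whose coloring has no
    infinite branch. *)
Lemma sparse_bounded (I : cardinal) (R : rel I) (Rwo : well_order R) (x0 : I)
    (T : Type) (cT : set T -> nat_language) :
  is_succ_cardinal kappa R x0 -> model sparse_diagrams cT -> emb T (beth Rwo x0).
Proof.
move=> x0S mT; apply: contrapT => big.
have Lk : emb nat_language kappa by have /setT_card_eq[] := nat_language_size.
have [w bw _] := big_branch ik x0S Lk mT big.
have [n nr] := c_wf (fun k => odflt k0 (w k).2); apply: nr.
apply: (@realized_le _ _ _ _ _ n.+3); first by rewrite -addn3 leq_addr.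
have [_ [[//]|[S Sn Sw]]] := bw n.+3; exists S => // k A AS Ak.
have [m mn Am] := card_I_sub AS Sn; rewrite (card_I_inj Am Ak) in mn.
by have /= -> := Sw (Ordinal mn) A AS Ak.
Qed.

(** Two copies of the point [None], with different colors [u], over the other
    points. *)
Lemma sparse_not_amalgamates (D : Prop) :
  ~ amalgamates D sparse_diagrams (X + Q)%type.
Proof.
have [col [colP colu]] := ex_ext_color; have [sz szE] := ex_size_of ext.
pose cu u (A : set ext) : nat_language := (sz A, col u A).
have mu u : model sparse_diagrams (cu u).
  by have [e p] := colP u; exact: ext_color_model szE e p.
have si : injective (@Some (X + Q)) by move=> a b [].
pose c0 (A : set (X + Q)) := cu None (Some @` A).
have e0 u : color_emb c0 (cu u) Some.
  split=> // n A _ _; congr (_, _); apply: colu.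
  by move=> [].
have iQ : emb nat (X + Q)%type.
  by apply: emb_trans ik _; exists (fun a => inr (Some a)) => a b [].
have sz1 : [set: ext] #= [set: (X + Q)%type].
  apply/setT_card_eq; split; last by exists Some.
  by apply: emb_option_inf => //; exact: emb_refl.
move=> AP; have [N [cN [f1 [f2 [mN e1 e2 fg _]]]]] :=
  AP _ _ _ c0 (cu None) (cu (Some k0)) Some Some
     (model_pull si (mu None)) (mu _) (mu _) (card_eqxx _) sz1 sz1 (e0 _) (e0 _).
have u12 : None <> Some k0 :> Q by [].
have [ecN _] := colP None; have [ecS _] := colP (Some k0).
have [fN|fN] := pselect (f1 None = f2 None).
  pose A : set ext := [set qpt None; qpt (Some k0); None].
  have A3 : A #= `I_3 by apply: card_I3.
  have fA : f1 @` A = f2 @` A by apply: eq_imagel => -[t|] _; [exact: fg|].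
  have := e1.2 3 A isT A3; rewrite fA (e2.2 3 A) // /cu => -[].
  have [_ _ _ h] := ecN; have [_ _ _ h'] := ecS.
  by rewrite (h _ _ u12) (h' _ _ u12).
pose p := [set f1 None; f2 None].
have p2 : p #= `I_2 by exact: card_I2.
pose q : Q := (cN p).2; pose z := f1 (qpt q).
have z2 : z = f2 (qpt q) by exact: fg.
have z1 : z <> f1 None by move=> /(e1.1).
have z3 : z <> f2 None by rewrite z2 => /(e2.1).
pose S := [set z; f1 None; f2 None].
have S3 : S #= `I_3 by apply: card_I3.
have cqN u : cu u [set qpt q; None] = (1, q) :> nat_language.
  rewrite /cu (szE 1); last exact: card_I2.
  by have [[_ _ -> _] _] := colP u.
have edge1 : cN [set z; f1 None] = (1, q).
  by rewrite -(cqN None) -(e1.2 2) ?image_setU ?image_set1 //; exact: card_I2.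
have edge2 : cN [set z; f2 None] = (1, q).
  rewrite z2 -(cqN (Some k0)) -(e2.2 2) ?image_setU ?image_set1 //.
  exact: card_I2.
have edge3 : cN p = (1, q).
  by have := mN.1 2 p isT p2; rewrite /q; case: (cN p) => m r /= [->].
have pt u (f : ext -> N) v : color_emb (cu u) cN f -> ~ range xpt v ->
    cN [set f v] = (0, None).
  move=> ef nv; rewrite (color_emb1 _ ef) /cu (szE 0); last exact: card_set1.
  by have [[_ -> // _ _] _] := colP u.
pose d (k : 'I_3) : nat_language :=
  if k == 0 :> nat then (0, None) else if k == 1 :> nat then (1, q) else cN S.
have Sd : is_diagram cN S d.
  move=> [[|[|[|//]]] k3] B BS /= Bk; rewrite /d /=.
  - move/card_I1P: Bk BS => [b ->] /(_ b erefl).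
    by move=> [[->|->]|->]; [apply: pt e1 _|apply: pt e1 _|apply: pt e2 _] => -[].
  - move/card_I2P: Bk BS => [b [b' [bb ->]]] BS.
    have Sb : S b by apply: BS; left.
    have Sb' : S b' by apply: BS; right.
    move: Sb Sb' bb => [[->|->]|->] [[->|->]|->] //= _; try exact: edge1;
      try exact: edge2; try exact: edge3; rewrite setUC;
      by [exact: edge1|exact: edge2|exact: edge3].
  - by rewrite (card_I_eq BS Bk S3).
have [_ [[//]|[S' S'3 S'd]]] := mN.2 3 S d S3 Sd.
have [x S'x] := card_nonempty (isT : 0 < 3) S'3.
have := S'd ord0 [set x]; rewrite /d /= => h.
have : None = Some (c [set x]) :> Q by apply: h; [move=> _ ->|exact: card_set1].
by [].
Qed.

End Lower.

(** * The Hanf numbers *)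

Section Hanf.
Variables (kappa I : cardinal) (R : rel I) (Rwo : well_order R) (x0 : I).
Hypotheses (ik : emb nat kappa) (x0S : is_succ_cardinal kappa R x0).
Let lam := beth Rwo x0.

Lemma succ_cardinal_limit : is_limit R x0.
Proof.
split=> [x0z|y yx0].
  have nb y : ~ below R x0 y by rewrite x0z.
  apply: (segment_succ x0S).
  exists (fun y => match nb _ (svalP y) with end) => y; case: (nb _ (svalP y)).
have x0y : below R x0 y by rewrite yx0; exact: wo_refl.
have [z + yz] := succ_next Rwo ik x0S x0y.
by rewrite yx0 => zy; apply: (below_notR Rwo yz).
Qed.

(** A smaller bound [mu] fails to be as large as some stage y < kappa^+.  A
    coloring of this stage without infinite branches yields a class that does
    not amalgamate in the cardinality of a set containing the stage, but
    amalgamates vacuously in large cardinalities. *)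
Lemma hanf_number (D : Prop) (AP : struct_class -> cardinal -> Prop) :
  (forall (L : language) (W : allowed_diagrams L) mu,
     AP (StructClass (coloring_class W)) mu <-> amalgamates D W mu) ->
  is_hanf_number (coloring_classes kappa) AP lam.
Proof.
move=> APE; split.
  move=> _ [L [W [Lk ->]]]; have {}Lk : emb L kappa by have /setT_card_eq[] := Lk.
  split=> [[mu [/card_ltP mul /APE AP1]] mu' /card_ltP mu'l|AP1].
    by apply/APE; apply: (amalgamates_transfer ik x0S Lk mul mu'l).
  have h : card_lt lam (set lam) by apply/card_ltP; exact: cantor.
  by exists (set lam); split=> //; apply: AP1.
move=> mu muH; apply: contrapT => nle.
have [y [yx0 nyx]] : exists y, below R x0 y /\ ~ emb (beth Rwo y) mu.
  apply: contrapT => h; apply: nle.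
  have [_ _ /(_ _ succ_cardinal_limit)[_ lub]] := beth_is_hierarchy Rwo.
  apply: lub => y yx0; apply/setT_card_le; apply: contrapT => n; apply: h.
  by exists y.
have [c c_wf] := wf_colorable_beth Rwo ik x0S yx0.
have [k0 _] : exists k : kappa, True by case: ik => e _; exists (e 0).
pose W := sparse_diagrams c.
have KW : coloring_classes kappa (StructClass (coloring_class W)).
  by exists (nat_language kappa), W; split=> //; exact: nat_language_size.
pose mu1 : cardinal := set (lam + mu).
have noemb (T : Type) : emb T (lam + mu)%type -> ~ emb mu1 T.
  by move=> T1 h; apply: (@cantor (lam + mu)%type); apply: emb_trans h T1.
have AP1 : AP (StructClass (coloring_class W)) mu1.
  apply/APE => T0 T1 T2 c0 c1 c2 g1 g2 m0 _ _ /setT_card_eq[_ muT0].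
  exfalso; apply: (noemb lam); first by exists inl => a b [].
  exact: emb_trans muT0 (sparse_bounded ik k0 c_wf Rwo x0S m0).
have [/(_ (ex_intro _ mu1 (conj _ AP1)))] := muH _ KW.
have h1 : card_lt mu mu1 by apply/card_ltP; apply: noemb; exists inr => a b [].
have h2 : card_lt mu (beth Rwo y + option kappa)%type.
  by apply/card_ltP => h; apply: nyx; apply: emb_trans h; exists inl => a b [].
by move=> /(_ h1) /(_ _ h2) /APE /(sparse_not_amalgamates ik k0).
Qed.

End Hanf.

Theorem mainTheorem4 (kappa : cardinal) (kappa_infinite : infinite_set [set: kappa]) :
  exists lam : cardinal,
    [/\ is_beth_succ kappa lam,
        is_hanf_number (coloring_classes kappa) amalgamation lam
      & is_hanf_number (coloring_classes kappa) disjoint_amalgamation lam].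
Proof.
have ik : emb nat kappa by apply/infinite_emb.
have [I [R [x0 [Rwo x0S]]]] := ex_succ_cardinal kappa.
exists (beth Rwo x0); split.
- exists I, R, x0, (beth Rwo); split=> //; exact: beth_is_hierarchy.
- by apply: (@hanf_number _ _ _ Rwo _ ik x0S False) => L W mu; exact: amalgamationP.
- by apply: (@hanf_number _ _ _ Rwo _ ik x0S True) => L W mu; exact: disjoint_amalgamationP.
Qed.
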